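(* Let $X=M_k$ be the $k$-th stage Bott tower over $\mathbb{C}$ with $k\ge2$, and let $1\le p\le k$, $1\le q\le 2k$ with $q\ne p,\,k+p$. Then there exists a collection of rank $2$ indecomposable equivariant vector bundles $\mathcal{E}_{p,q}$ on $X$ (one for each such pair $(p,q)$) with $c_1(\mathcal{E}_{p,q})=D_p+D_q+D_{k+p}$.
   Context: A Bott tower $M_k\to M_{k-1}\to\cdots\to M_1\to M_0=\{\text{point}\}$ is an iterated sequence of $\mathbb{P}^1$-bundles; $M_k$ is the nonsingular projective toric variety with fan $\Delta_k$ in $N=\mathbb{Z}^k$ (standard basis $e_1,\ldots,e_k$) having ray generators $v_i=e_i$ for $1\le i\le k$, $v_{k+i}=-e_i+c_{i,i+1}e_{i+1}+\cdots+c_{i,k}e_k$ for $1\le i\le k-1$, and $v_{2k}=-e_k$, where the Bott numbers $c_{i,j}$ ($1\le i<j\le k$) are non-negative integers (which can be assumed without loss of generality). The $2^k$ maximal cones are the $k$-dimensional cones generated by choosing exactly one of $v_i,v_{k+i}$ for each $i=1,\ldots,k$. $D_i$ is the torus-invariant prime divisor corresponding to $v_i$, $1\le i\le 2k$. A vector bundle is equivariant if it admits a lift of the torus action on $X$, linear on fibres; it is indecomposable if it is not a direct sum of two nonzero vector bundles. *)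

(* Defs.v *)
From mathcomp Require Import all_boot all_order all_algebra.
From mathcomp Require Import classical_sets.

Set Implicit Arguments.
Unset Strict Implicit.
Unset Printing Implicit Defensive.

Import Order.TTheory GRing.Theory Num.Theory.
Local Open Scope ring_scope.
Local Open Scope classical_set_scope.

(** A classical (pre)variety over [K], described by its closed points, a cover
    by affine charts [dom c], and for each chart the coordinate ring, given as
    [K]-valued functions.  The values of [f] outside [dom c] are irrelevant when
    [fn c f]. *)
Record prevariety (K : fieldType) := Prevariety {
  point :> Type;
  chart : Type;
  dom : chart -> set point;
  fn : chart -> set (point -> K);
  dom_cover : forall x, exists c, dom c x;
  fn_cst : forall c (a : K), fn c (fun=> a)
}.

Section Zariski.
Variables (K : fieldType) (X : prevariety K).
Implicit Types (U V W D : set X) (F G f g h : X -> K).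

Definition basic_open (c : chart X) f : set X := [set x | dom c x /\ f x != 0].

(** The Zariski topology, with the principal opens of the charts as a subbase.
    The library's topological structures are not used because a product of
    varieties must not receive the product topology. *)
Definition zopen U := forall x, U x ->
  exists n (c : 'I_n -> chart X) (f : 'I_n -> X -> K),
    [/\ forall l, fn (c l) (f l),
        forall l, basic_open (c l) (f l) x
      & forall y, (forall l, basic_open (c l) (f l) y) -> U y].

Definition zclosure (A : set X) : set X :=
  [set x | forall U, zopen U -> U x -> exists2 y, A y & U y].

(** [F] is a regular function on [U]: locally a quotient of two elements of a
    coordinate ring. *)
Definition regular U F := forall x, U x ->
  exists (W : set X) (c : chart X) (f g : X -> K),
    [/\ zopen W, W x, W `<=` dom c, fn c f /\ fn c g
      & forall y, U y -> W y -> g y != 0 /\ F y = f y / g y].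

Definition regular_mx m n U (A : X -> 'M[K]_(m, n)) :=
  forall a b, regular U (fun x => A x a b).

(** [f] generates the ideal sheaf of [D] on the open set [W]. *)
Definition local_equation D W f :=
  regular W f /\
  forall V g, zopen V -> V `<=` W -> regular V g ->
    (forall y, V y -> D y -> g y = 0) <->
    (exists2 h, regular V h & forall y, V y -> g y = f y * h y).

Lemma regularS U V F : V `<=` U -> regular U F -> regular V F.
Proof.
move=> VU rF x /VU Ux; have [W [c [f [g [? ? ? ? H]]]]] := rF x Ux.
by exists W, c, f, g; split=> // y /VU; apply: H.
Qed.

Lemma regular_ext U F G :
  (forall x, F x = G x) -> regular U F -> regular U G.
Proof.
move=> FG rF x /rF[W [c [f [g [? ? ? ? H]]]]].
by exists W, c, f, g; split=> // y Uy Wy; rewrite -FG; apply: H.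
Qed.

Lemma regular_cst U (a : K) : regular U (fun=> a).
Proof.
move=> x _; have [c cx] := dom_cover x.
exists (dom c), c, (fun=> a), (fun=> 1); split=> //.
- move=> y cy; exists 1%N, (fun=> c), (fun=> fun=> 1).
  split=> [_|_|z /(_ ord0) []//]; first exact: fn_cst.
  by split=> //; apply: oner_neq0.
- by split; apply: fn_cst.
- by move=> y _ _; rewrite oner_neq0 divr1.
Qed.

Lemma zopenI U V : zopen U -> zopen V -> zopen (U `&` V).
Proof.
move=> oU oV x [/oU[n [c [f [h1 h2 h3]]]] /oV[m [d [g [k1 k2 k3]]]]].
pose e l := match split l with inl i => c i | inr i => d i end.
pose h l := match split l with inl i => f i | inr i => g i end.
exists (n + m)%N, e, h; split=> [l|l|y H]; rewrite /e /h.
- by case: split.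
- by case: split => i; [apply: h2|apply: k2].
- split.
  + by apply: h3 => i; move: (H (lshift m i)); rewrite /e /h (unsplitK (inl i)).
  + by apply: k3 => i; move: (H (rshift n i)); rewrite /e /h (unsplitK (inr i)).
Qed.

End Zariski.

(** On a product of charts, the coordinate ring is the tensor product of the
    coordinate rings. *)
Section Product.
Variables (K : fieldType) (X Y : prevariety K).

Definition prod_fn (c : chart X * chart Y) : set (X * Y -> K) :=
  [set F | exists n (f : 'I_n -> X -> K) (g : 'I_n -> Y -> K),
    (forall l, fn c.1 (f l) /\ fn c.2 (g l)) /\
    (forall z, F z = \sum_(l < n) f l z.1 * g l z.2)].

Lemma prod_dom_cover (z : X * Y) :
  exists c : chart X * chart Y, (dom c.1 `*` dom c.2) z.
Proof.
by have [c ?] := dom_cover z.1; have [d ?] := dom_cover z.2; exists (c, d).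
Qed.

Lemma prod_fn_cst c (a : K) : prod_fn c (fun=> a).
Proof.
exists 1%N, (fun=> fun=> a), (fun=> fun=> 1); split=> [l|z].
  by split; apply: fn_cst.
by rewrite big_ord1 mulr1.
Qed.

Definition prod_prevariety : prevariety K :=
  @Prevariety K (X * Y)%type _ (fun c => dom c.1 `*` dom c.2) prod_fn
    prod_dom_cover prod_fn_cst.

End Product.

(** An algebraic vector bundle of constant rank: fibres [fib x] together with
    local trivializations [triv i x : fib x -> K^rk], linear isomorphisms for
    [x] in the open set [tdom i], whose transition matrices [trans i j] are
    regular on the overlaps. *)
Record vbundle (K : fieldType) (X : prevariety K) := Vbundle {
  rk : nat;
  fib : X -> lmodType K;
  tidx : Type;
  tdom : tidx -> set X;
  triv : tidx -> forall x, fib x -> 'cV[K]_rk;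
  trans : tidx -> tidx -> X -> 'M[K]_rk;
  tdom_open : forall i, zopen (tdom i);
  tdom_cover : forall x, exists i, tdom i x;
  triv_linear : forall i x, tdom i x -> linear (@triv i x);
  triv_bij : forall i x, tdom i x -> bijective (@triv i x);
  trans_regular : forall i j, regular_mx (tdom i `&` tdom j) (trans i j);
  transE : forall i j x, tdom i x -> tdom j x ->
    forall v : fib x, @triv j x v = trans i j x *m @triv i x v
}.
Arguments fib {K X} _ x.
Arguments triv {K X _} i x _.

Section Bundles.
Variables (K : fieldType) (X : prevariety K).
Implicit Types E F G : vbundle X.

Definition bundle_morphism E F (phi : forall x, fib E x -> fib F x) :=
  (forall x, linear (@phi x)) /\
  forall (i : tidx E) (j : tidx F),
    exists2 A : X -> 'M[K]_(rk F, rk E),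
      regular_mx (tdom i `&` tdom j) A &
      forall x, tdom i x -> tdom j x ->
        forall v, triv j x (phi x v) = A x *m triv i x v.

Definition bundle_iso E F :=
  exists (phi : forall x, fib E x -> fib F x)
         (psi : forall x, fib F x -> fib E x),
    [/\ bundle_morphism phi, bundle_morphism psi,
        forall x, cancel (@phi x) (@psi x) & forall x, cancel (@psi x) (@phi x)].

Section DirectSum.
Variables E F : vbundle X.

Definition dsum_fib (x : X) : lmodType K := (fib E x * fib F x)%type.
Definition dsum_tdom (i : tidx E * tidx F) : set X := tdom i.1 `&` tdom i.2.
Definition dsum_triv (i : tidx E * tidx F) x (v : dsum_fib x) :
    'cV[K]_(rk E + rk F) :=
  col_mx (triv i.1 x v.1) (triv i.2 x v.2).
Definition dsum_trans (i j : tidx E * tidx F) x : 'M[K]_(rk E + rk F) :=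
  block_mx (trans i.1 j.1 x) 0 0 (trans i.2 j.2 x).

Lemma dsum_tdom_open i : zopen (dsum_tdom i).
Proof. by apply: zopenI; apply: tdom_open. Qed.

Lemma dsum_tdom_cover x : exists i, dsum_tdom i x.
Proof.
by have [i ?] := tdom_cover E x; have [j ?] := tdom_cover F x; exists (i, j).
Qed.

Lemma dsum_triv_linear i x : dsum_tdom i x -> linear (@dsum_triv i x).
Proof.
move=> [h1 h2] a u v; rewrite /dsum_triv /=.
by rewrite (triv_linear h1) (triv_linear h2) scale_col_mx add_col_mx.
Qed.

Lemma dsum_triv_bij i x : dsum_tdom i x -> bijective (@dsum_triv i x).
Proof.
move=> [/triv_bij[f f1 f2] /triv_bij[g g1 g2]].
exists (fun w => (f (usubmx w), g (dsubmx w))) => [[u v]|w].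
  by rewrite /dsum_triv /= col_mxKu col_mxKd f1 g1.
by rewrite /dsum_triv /= f2 g2 vsubmxK.
Qed.

Lemma dsum_trans_regular i j :
  regular_mx (dsum_tdom i `&` dsum_tdom j) (dsum_trans i j).
Proof.
have h1 : dsum_tdom i `&` dsum_tdom j `<=` tdom i.1 `&` tdom j.1.
  by move=> x [[? ?] [? ?]].
have h2 : dsum_tdom i `&` dsum_tdom j `<=` tdom i.2 `&` tdom j.2.
  by move=> x [[? ?] [? ?]].
move=> a b; rewrite /dsum_trans -(splitK a) -(splitK b).
case: (split a) (split b) => a' [] b' /=.
- apply: regular_ext (regularS h1 (trans_regular a' b')) => x.
  by rewrite block_mxEul.
- by apply: regular_ext (@regular_cst _ _ _ 0) => x; rewrite block_mxEur mxE.
- by apply: regular_ext (@regular_cst _ _ _ 0) => x; rewrite block_mxEdl mxE.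
- apply: regular_ext (regularS h2 (trans_regular a' b')) => x.
  by rewrite block_mxEdr.
Qed.

Lemma dsum_transE i j x : dsum_tdom i x -> dsum_tdom j x ->
  forall v, dsum_triv j v = dsum_trans i j x *m dsum_triv i (x := x) v.
Proof.
move=> [i1 i2] [j1 j2] v; rewrite /dsum_triv /dsum_trans mul_block_col.
by rewrite !mul0mx addr0 add0r -!transE.
Qed.

Definition dsum : vbundle X :=
  @Vbundle K X (rk E + rk F) dsum_fib (tidx E * tidx F)%type dsum_tdom
    dsum_triv dsum_trans dsum_tdom_open dsum_tdom_cover dsum_triv_linear
    dsum_triv_bij dsum_trans_regular dsum_transE.

End DirectSum.

Definition indecomposable E :=
  ~ exists F G, [/\ (0 < rk F)%N, (0 < rk G)%N & bundle_iso E (dsum F G)].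

(** [s] is a rational section of the line bundle [det E], regular away from the
    prime divisors [D l], whose divisor is [\sum_l a l * D l].  The section is
    given by its coordinates in the trivializations of [det E] induced by those
    of [E], with transition functions [\det (trans i j)]; locally it is a unit
    times the product of the [f l ^ a l] for local equations [f l] of [D l]. *)
Definition det_section_div E (I : finType) (D : I -> set X) (a : I -> int)
    (s : tidx E -> X -> K) :=
  let U := [set x | forall l, ~ D l x] in
  (forall i j x, U x -> tdom i x -> tdom j x ->
     s j x = \det (trans i j x) * s i x) /\
  (forall i x, tdom i x ->
     exists (W : set X) (u : X -> K) (f : I -> X -> K),
       [/\ zopen W, W x /\ W `<=` tdom i,
           regular W u /\ (forall y, W y -> u y != 0),
           forall l, local_equation (D l) W (f l)
         & forall y, W y -> U y -> s i y = u y * \prod_l f l y ^ a l]).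

(** [c_1(E) = \sum_l a l * D l] in the divisor class group: [c_1(E)] is
    [c_1(det E)], the class of the divisor of any nonzero rational section of
    [det E]; hence the equality says that some section has exactly this
    divisor. *)
Definition c1_eq E (I : finType) (D : I -> set X) (a : I -> int) :=
  exists s, @det_section_div E I D a s.

End Bundles.

(** Combinatorial data of a simplicial fan in [Z^k]: primitive ray generators
    and the sets of rays spanning the maximal cones.  The cones of the fan are
    then spanned by the subsets of these sets.  Characters and cocharacters are
    both row vectors. *)
Record fan (k n : nat) := Fan {
  ray : 'I_n -> 'rV[int]_k;
  maxcones : {set {set 'I_n}}
}.

Section ToricVariety.
Variables (K : fieldType) (k n : nat) (Sigma : fan k n).
Implicit Types (sigma tau : {set 'I_n}) (m : 'rV[int]_k).

Definition pairing (m v : 'rV[int]_k) : int := \sum_(i < k) m 0 i * v 0 i.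

Definition is_cone tau := [exists sigma in maxcones Sigma, tau \subset sigma].
Definition dual_cone tau m := [forall i in tau, 0 <= pairing m (ray Sigma i)].
Definition perp_cone tau m := [forall i in tau, pairing m (ray Sigma i) == 0].

(** The closed points of the affine toric variety [U_sigma] are the monoid
    morphisms from [dual_cone sigma] to the multiplicative monoid [K].  Such a
    point lies in no smaller chart of the gluing iff it vanishes exactly outside
    [perp_cone sigma].  A point of the toric variety is represented in its
    smallest chart, [tcone x], so that [x] lies in the orbit of [tcone x]; its
    character values [tval x] are extended by [0] outside
    [dual_cone (tcone x)]. *)
Record tpoint := Tpoint {
  tcone : {set 'I_n};
  tval : 'rV[int]_k -> K;
  tcone_fan : is_cone tcone;
  tval0 : tval 0 = 1;
  tvalD : forall m1 m2, dual_cone tcone m1 -> dual_cone tcone m2 ->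
    tval (m1 + m2) = tval m1 * tval m2;
  tval_neq0 : forall m, (tval m != 0) = perp_cone tcone m
}.

Definition tchart := {sigma : {set 'I_n} | is_cone sigma}.

Definition tdomain (c : tchart) : set tpoint :=
  [set x | tcone x \subset val c].

(** The coordinate ring of [U_sigma] is spanned by the characters in
    [dual_cone sigma]. *)
Definition tfn (c : tchart) : set (tpoint -> K) :=
  [set f | exists r (a : 'I_r -> K) (m : 'I_r -> 'rV[int]_k),
    (forall l, dual_cone (val c) (m l)) /\
    (forall x, f x = \sum_(l < r) a l * tval x (m l))].

Lemma tdomain_cover x : exists c, tdomain c x.
Proof. by exists (Sub (tcone x) (tcone_fan x)); rewrite /tdomain /=. Qed.

Lemma tfn_cst c (a : K) : tfn c (fun=> a).
Proof.
exists 1%N, (fun=> a), (fun=> 0); split=> [l|x].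
  by apply/forall_inP => i _; rewrite /pairing big1 // => j _; rewrite mxE mul0r.
by rewrite big_ord1 tval0 mulr1.
Qed.

Definition toric_variety : prevariety K :=
  @Prevariety K tpoint tchart tdomain tfn tdomain_cover tfn_cst.

Definition torbit tau : set toric_variety :=
  [set x : tpoint | tcone x = tau].

(** The torus-invariant prime divisor of the [i]-th ray. *)
Definition tdivisor (i : 'I_n) : set toric_variety := zclosure (torbit [set i]).

End ToricVariety.

(** The torus of group morphisms from [Z^k] to the units of [K]. *)
Section Torus.
Variables (K : fieldType) (k : nat).

Record tpt := Tpt {
  chi : 'rV[int]_k -> K;
  chi0 : chi 0 = 1;
  chiD : forall m1 m2, chi (m1 + m2) = chi m1 * chi m2
}.

Definition torus_fn (_ : unit) : set (tpt -> K) :=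
  [set f | exists r (a : 'I_r -> K) (m : 'I_r -> 'rV[int]_k),
    forall t, f t = \sum_(l < r) a l * chi t (m l)].

Lemma torus_cover (t : tpt) : exists c : unit, [set: tpt] t.
Proof. by exists tt. Qed.

Lemma torus_fn_cst c (a : K) : torus_fn c (fun=> a).
Proof.
by exists 1%N, (fun=> a), (fun=> 0) => t; rewrite big_ord1 chi0 mulr1.
Qed.

Definition torus : prevariety K :=
  @Prevariety K tpt unit (fun=> [set: tpt]) torus_fn torus_cover torus_fn_cst.

Lemma chi_neq0 (t : tpt) m : chi t m != 0.
Proof.
apply/eqP => h; have := chi0 t; rewrite -(subrr m) chiD h mul0r => /esym/eqP.
by rewrite oner_eq0.
Qed.

Definition torus1 : tpt.
Proof. by exists (fun=> 1) => // m1 m2; rewrite mulr1. Defined.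

Definition torusM (t s : tpt) : tpt.
Proof.
exists (fun m => chi t m * chi s m) => [|m1 m2].
  by rewrite !chi0 mulr1.
by rewrite !chiD mulrACA.
Defined.

End Torus.

Section Equivariance.
Variables (K : fieldType) (k n : nat) (Sigma : fan k n).
Let X := toric_variety K Sigma.
Let T := torus K k.

Definition tact (t : T) (x : X) : X.
Proof.
exists (tcone x) (fun m => chi t m * tval x m) => [||m1 m2 h1 h2|m].
- exact: tcone_fan.
- by rewrite chi0 tval0 mulr1.
- by rewrite chiD tvalD // mulrACA.
- by rewrite mulf_eq0 (negPf (chi_neq0 t m)) tval_neq0.
Defined.

(** The maps [Phi t x : E_x -> E_(t x)] define an action of the torus on the
    total space of [E]. *)
Definition total_act (E : vbundle X)
    (Phi : forall (t : T) (x : X), fib E x -> fib E (tact t x))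
    (t : T) (e : {x : X & fib E x}) : {x : X & fib E x} :=
  existT _ (tact t (projT1 e)) (Phi t (projT1 e) (projT2 e)).

(** [E] admits a lift of the torus action on [X] to an algebraic action on its
    total space which is linear on the fibres. *)
Definition equivariant (E : vbundle X) :=
  exists Phi : forall (t : T) (x : X), fib E x -> fib E (tact t x),
    [/\ forall t x, linear (Phi t x),
        forall e, total_act Phi (torus1 K k) e = e,
        forall t s e,
          total_act Phi (torusM t s) e = total_act Phi t (total_act Phi s e)
      & forall i j : tidx E,
          let U : set (prod_prevariety T X) :=
            [set z | tdom i z.2 /\ tdom j (tact z.1 z.2)] in
          exists2 A : prod_prevariety T X -> 'M[K]_(rk E),
            regular_mx U A &
            forall t x, U (t, x) -> forall v,
              triv j (tact t x) (Phi t x v) = A (t, x) *m triv i x v].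

End Equivariance.

Section BottTower.
Variables (k : nat) (c : 'I_k -> 'I_k -> nat).

(** [v_i] is indexed by [lshift k i] and [v_(k+i)] by [rshift k i]; only the
    [c i j] with [i < j] are used. *)
Definition bott_ray (l : 'I_(k + k)) : 'rV[int]_k :=
  match split l with
  | inl i => delta_mx 0 i
  | inr i => - delta_mx 0 i + \sum_(j < k | (i < j)%N) delta_mx 0 j *+ c i j
  end.

(** Exactly one of [v_i], [v_(k+i)] for each [i]. *)
Definition bott_maxcones : {set {set 'I_(k + k)}} :=
  [set S : {set 'I_(k + k)} |
    [forall i : 'I_k, (lshift k i \in S) (+) (rshift k i \in S)]].

Definition bott_fan : fan k (k + k) := Fan bott_ray bott_maxcones.

Definition bott_tower (K : fieldType) : prevariety K :=
  toric_variety K bott_fan.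

End BottTower.

(* Main.v *)
From mathcomp Require Import all_boot all_order all_algebra.
From mathcomp Require Import boolp classical_sets reals.
From mathcomp Require Import complex ring.
Require Import Defs.

Set Implicit Arguments.
Unset Strict Implicit.
Unset Printing Implicit Defensive.

Import Order.TTheory GRing.Theory Num.Theory.
Local Open Scope ring_scope.
Local Open Scope classical_set_scope.

(** Write [r] for the index with [q] among [v_r], [v_(k+r)], so that [r != p].
    Choose three distinct lines in [K^2], spanned by [e_p = (1,0)], [e_q = (0,1)]
    and [e_(k+p) = e_p - e_q], and let [E] be the bundle whose sections are the
    [K^2]-valued functions with at most simple poles along [D_p], [D_q] and
    [D_(k+p)], in the direction of the line of the same index.  No maximal cone
    contains both [v_p] and [v_(k+p)], so at most two of the three lines matter
    on an affine chart, and there [E] is free: if [h] and [g] are the characters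
    cutting out [D_p + D_(k+p)] and [D_q] in the chart, a basis is [e_p / h] or
    [e_(k+p) / h], according to the side of the chart, together with [e_q / g].
    Comparing two such bases gives the transition matrices [ptrans], whose
    entries are multiples of single characters; the torus acts on the bases
    through characters, which is the equivariant structure; and the section
    [e_p /\ e_q] of the determinant has the coordinate [h * g] in each chart, so
    that its divisor is [D_p + D_q + D_(k+p)].  That [D_l] is
    cut out by a character is [local_equation_bdiv].

    Indecomposability.  A decomposition gives an idempotent endomorphism whose
    value in each fibre is not a scalar ([decomposable_idempotent]); it suffices
    to find one fibre where the matrix [[a, b], [e, d]] of the endomorphism, in
    the above basis, has [a = d] and [b * e = 0], since an idempotent of this
    form is a scalar ([idempotent_scalar]).  This happens on a toric surface on
    which only the coordinates [x] (for [p]) and [y] (for [r]) are nonzero, and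
    for one of two reasons ([scalar_point]).
    - If [r < p], the lines [y = const] join [D_p] to [D_(k+p)].  Along such a
      line [E] is [O(1) + O(1)] for [y != 0] but [O(2) + O] on [D_q], where
      [y = 0].  The matrix thus depends on [x] in a prescribed way when
      [y != 0], which forces [(a - d)(0,y)] to be a multiple of [y], while on
      the line [y = 0] the entry [e] vanishes.
    - If [p < r], the lines [x = const] join [D_q] to the opposite divisor.
      Along them [E] is [O(1) + O], and the endomorphism must preserve the
      subbundle spanned by [e_q]; hence [b = 0] on the opposite divisor.  That
      divisor contains a line joining [D_p] to [D_(k+p)], along which [E] is
      [O(1) + O(1)], and there [b = 0] forces [a = d].

    Both arguments only concern functions of one variable.  Regular functions
    are restricted to curves given by polynomials in the affine coordinates of a
    chart, where they become locally quotients of polynomials ([rational_at]);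
    such a function on the affine line over an algebraically closed field is a
    polynomial ([entire_poly]), and its degree is bounded by its order at
    infinity ([size_pole_at_infinity]).  The coordinate changes needed to pass
    through infinity are provided by [bpt_flip]. *)

(** * Functions of one variable *)

Section RationalGerms.
Variable K : fieldType.
Implicit Types (z : K) (P Q : K -> Prop) (F G : K -> K).

(** The neighbourhoods of [z] are cofinite, hence given by a polynomial. *)
Definition znear z P :=
  exists2 B : {poly K}, B.[z] != 0 & forall w, B.[w] != 0 -> P w.

Definition rational_at z F :=
  exists A B : {poly K},
    B.[z] != 0 /\ forall w, B.[w] != 0 -> F w = A.[w] / B.[w].

Lemma znearS z P Q : (forall w, P w -> Q w) -> znear z P -> znear z Q.
Proof. by move=> PQ [B Bz H]; exists B => // w /H/PQ. Qed.

Lemma znearT z P : (forall w, P w) -> znear z P.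
Proof. by move=> H; exists 1 => // ; rewrite hornerC oner_neq0. Qed.

Lemma znear_and z P Q : znear z P -> znear z Q -> znear z (fun w => P w /\ Q w).
Proof.
move=> [B Bz HB] [C Cz HC]; exists (B * C); first by rewrite hornerM mulf_neq0.
by move=> w; rewrite hornerM mulf_eq0 negb_or => /andP[/HB ? /HC].
Qed.

Lemma znear_all (I : finType) z (P : I -> K -> Prop) :
  (forall i, znear z (P i)) -> znear z (fun w => forall i, P i w).
Proof.
move=> H; suff H' (s : seq I) : znear z (fun w => forall i, i \in s -> P i w).
  by apply: znearS (H' (enum I)) => w Pw i; apply: Pw; rewrite mem_enum.
elim: s => [|i s IH]; first exact: znearT.
apply: znearS (znear_and (H i) IH) => w [Pi Ps] j.
by rewrite inE => /orP[/eqP->|/Ps].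
Qed.

Lemma znear_poly z (B : {poly K}) : B.[z] != 0 -> znear z (fun w => B.[w] != 0).
Proof. by move=> Bz; exists B. Qed.

Lemma rational_at_near z F G :
  znear z (fun w => F w = G w) -> rational_at z F -> rational_at z G.
Proof.
move=> [C Cz FG] [A [B [Bz H]]]; exists (A * C), (B * C); split.
  by rewrite hornerM mulf_neq0.
move=> w; rewrite !hornerM mulf_eq0 negb_or => /andP[Bw Cw].
by rewrite -FG // H // -mulf_div divff // mulr1.
Qed.

Lemma rational_at_ext z F G :
  (forall w, F w = G w) -> rational_at z F -> rational_at z G.
Proof. by move=> FG; apply: rational_at_near; apply: znearT. Qed.

Lemma rational_at_poly z (A : {poly K}) : rational_at z (fun w => A.[w]).
Proof. by exists A, 1; split=> [|w _]; rewrite hornerC ?oner_neq0 ?divr1. Qed.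

Lemma rational_at_cst z a : rational_at z (fun=> a).
Proof. by apply: rational_at_ext (rational_at_poly z a%:P) => w; rewrite hornerC. Qed.

Lemma rational_at_id z : rational_at z id.
Proof. by apply: rational_at_ext (rational_at_poly z 'X) => w; rewrite hornerX. Qed.

Lemma rational_atD z F G : rational_at z F -> rational_at z G ->
  rational_at z (fun w => F w + G w).
Proof.
move=> [A [B [Bz HF]]] [C [D [Dz HG]]]; exists (A * D + C * B), (B * D); split.
  by rewrite hornerM mulf_neq0.
move=> w; rewrite hornerD !hornerM mulf_eq0 negb_or => /andP[Bw Dw].
by rewrite HF // HG // addf_div.
Qed.

Lemma rational_atM z F G : rational_at z F -> rational_at z G ->
  rational_at z (fun w => F w * G w).
Proof.
move=> [A [B [Bz HF]]] [C [D [Dz HG]]]; exists (A * C), (B * D); split.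
  by rewrite hornerM mulf_neq0.
move=> w; rewrite !hornerM mulf_eq0 negb_or => /andP[Bw Dw].
by rewrite HF // HG // mulf_div.
Qed.

Lemma rational_atN z F : rational_at z F -> rational_at z (fun w => - F w).
Proof.
move=> rF; apply: rational_at_ext (rational_atM (rational_at_cst z (-1)) rF) => w.
by rewrite mulN1r.
Qed.

Lemma rational_atB z F G : rational_at z F -> rational_at z G ->
  rational_at z (fun w => F w - G w).
Proof. by move=> rF rG; apply: rational_atD rF _; apply: rational_atN. Qed.

Lemma rational_atV z F : F z != 0 -> rational_at z F ->
  rational_at z (fun w => (F w)^-1).
Proof.
move=> Fz [A [B [Bz HF]]].
have Az : A.[z] != 0 by apply: contraNneq Fz => Az; rewrite HF // Az mul0r.
exists (B ^+ 2), (A * B); split; first by rewrite hornerM mulf_neq0.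
move=> w; rewrite hornerM mulf_eq0 negb_or => /andP[Aw Bw].
by rewrite HF // invf_div expr2 hornerM -mulf_div divff // mulr1.
Qed.

Lemma znear_neq0 z F : rational_at z F -> F z != 0 -> znear z (fun w => F w != 0).
Proof.
move=> [A [B [Bz HF]]] Fz.
have Az : A.[z] != 0 by apply: contraNneq Fz => Az; rewrite HF // Az mul0r.
exists (A * B); first by rewrite hornerM mulf_neq0.
move=> w; rewrite hornerM mulf_eq0 negb_or => /andP[Aw Bw].
by rewrite HF // mulf_neq0 // invr_neq0.
Qed.

Lemma rational_atX z F n : rational_at z F -> rational_at z (fun w => F w ^+ n).
Proof.
move=> rF; elim: n => [|n IH]; first exact: rational_at_cst.
by apply: rational_at_ext (rational_atM rF IH) => w; rewrite exprS.
Qed.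

Lemma rational_atXz z F (n : int) : 0 <= n \/ F z != 0 ->
  rational_at z F -> rational_at z (fun w => F w ^ n).
Proof.
case: n => n; first by move=> _; apply: rational_atX.
case=> // Fz rF; apply: rational_atV; first by rewrite expf_neq0.
exact: rational_atX.
Qed.

Lemma rational_at_sum (I : Type) (r : seq I) z (F : I -> K -> K) :
  (forall i, rational_at z (F i)) -> rational_at z (fun w => \sum_(i <- r) F i w).
Proof.
move=> rF; elim: r => [|i r IH].
  by apply: rational_at_ext (rational_at_cst z 0) => w; rewrite big_nil.
by apply: rational_at_ext (rational_atD (rF i) IH) => w; rewrite big_cons.
Qed.

Lemma rational_at_prod (I : Type) (r : seq I) z (F : I -> K -> K) :
  (forall i, rational_at z (F i)) -> rational_at z (fun w => \prod_(i <- r) F i w).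
Proof.
move=> rF; elim: r => [|i r IH].
  by apply: rational_at_ext (rational_at_cst z 1) => w; rewrite big_nil.
by apply: rational_at_ext (rational_atM (rF i) IH) => w; rewrite big_cons.
Qed.

Definition rational_mx m n z (A : K -> 'M[K]_(m, n)) :=
  forall i j, rational_at z (fun w => A w i j).

Lemma rational_mxM m n p z (A : K -> 'M[K]_(m, n)) (B : K -> 'M[K]_(n, p)) :
  rational_mx z A -> rational_mx z B -> rational_mx z (fun w => A w *m B w).
Proof.
move=> rA rB i j.
apply: rational_at_ext (rational_at_sum (index_enum _)
  (fun l => rational_atM (rA i l) (rB l j))) => w.
by rewrite mxE.
Qed.

Lemma rational_mx_cst m n z (A : 'M[K]_(m, n)) : rational_mx z (fun=> A).
Proof. by move=> i j; apply: rational_at_cst. Qed.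

End RationalGerms.

Section Entire.
Variable K : closedFieldType.
Implicit Types (z : K) (F G : K -> K) (A B P Q : {poly K}).

Lemma poly_nonroot P : P != 0 -> exists z, P.[z] != 0.
Proof.
move=> P0; have [sP|sP] := eqVneq (size P) 1%N.
  have /size1_polyC E : (size P <= 1)%N by rewrite sP.
  by exists 0; move: P0; rewrite E hornerC polyC_eq0.
(* At a root of [P - 1] the value of [P] is [1]. *)
have /closed_rootP[z /rootP Pz] : size (P - 1) != 1%N.
  have sP1 : (1 < size P)%N by rewrite ltn_neqAle eq_sym sP lt0n size_poly_eq0.
  by rewrite size_polyDl ?sP // size_polyN size_poly1.
exists z; have /eqP := Pz; rewrite hornerD hornerN hornerC subr_eq0 => /eqP->.
exact: oner_neq0.
Qed.

Lemma poly_eq_off P Q B : B != 0 ->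
  (forall w, B.[w] != 0 -> P.[w] = Q.[w]) -> P = Q.
Proof.
move=> B0 H; apply/eqP; rewrite -subr_eq0; apply/negPn/negP => PQ.
have [w] := poly_nonroot (mulf_neq0 PQ B0).
rewrite hornerM mulf_eq0 negb_or => /andP[+ Bw].
by rewrite hornerD hornerN H // subrr eqxx.
Qed.

Lemma horner_neq0 B z : B.[z] != 0 -> B != 0.
Proof. by apply: contra_neq => ->; rewrite horner0. Qed.

(** Clearing denominators turns the equality into one of polynomials, which
    holds at [z] as soon as it holds off a finite set: this is the form in which
    continuity is used below. *)
Lemma rational_at_unique z F G B : rational_at z F -> rational_at z G -> B != 0 ->
  (forall w, B.[w] != 0 -> F w = G w) -> F z = G z.
Proof.
move=> [A [C [Cz HF]]] [A' [C' [C'z HG]]] B0 FG.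
have E : A * C' = A' * C.
  apply: (@poly_eq_off _ _ (B * (C * C'))).
    by rewrite !mulf_neq0 // ?(horner_neq0 Cz) ?(horner_neq0 C'z).
  move=> w; rewrite !hornerM !mulf_eq0 !negb_or => /and3P[Bw Cw C'w].
  by apply/eqP; rewrite -eqr_div // -HF // -HG // FG.
by rewrite HF // HG //; apply/eqP; rewrite eqr_div // -!hornerM E.
Qed.

Lemma rational_at_limit z F G : rational_at z F -> rational_at z G ->
  znear z (fun w => w != z -> F w = G w) -> F z = G z.
Proof.
move=> rF rG [B Bz H]; apply: (@rational_at_unique _ _ _ (B * ('X - z%:P))) => //.
  by rewrite mulf_neq0 ?polyXsubC_eq0 // (horner_neq0 Bz).
by move=> w; rewrite hornerM hornerXsubC mulf_eq0 negb_or subr_eq0 => /andP[/H].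
Qed.

(** In lowest terms, the denominator at one point divides the denominators at
    all others, hence it has no zeros. *)
Lemma entire_poly F : (forall z, rational_at z F) -> exists P, forall z, F z = P.[z].
Proof.
move=> rF; have [A [B [B0 HF]]] := rF 0.
have nzB := horner_neq0 B0.
pose D := gcdp A B; have D0 : D != 0 by rewrite gcdp_eq0 negb_and nzB orbT.
pose A1 := A %/ D; pose B1 := B %/ D.
have EA : A = A1 * D by rewrite divpK // dvdp_gcdl.
have EB : B = B1 * D by rewrite divpK // dvdp_gcdr.
have co : coprimep B1 A1.
  by rewrite coprimep_sym /A1 /B1 coprimep_div_gcd // nzB orbT.
have key z : B1.[z] != 0 /\ F z = A1.[z] / B1.[z].
  have [A' [B' [B'z HF']]] := rF z; have nzB' := horner_neq0 B'z.
  have E : A1 * B' = A' * B1.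
    apply: (@poly_eq_off _ _ (B * B')); first by rewrite mulf_neq0.
    move=> w; rewrite !hornerM mulf_eq0 negb_or => /andP[Bw B'w].
    have: F w = A'.[w] / B'.[w] by rewrite HF'.
    rewrite HF // => /eqP; rewrite eqr_div // EA EB !hornerM.
    have Dw : D.[w] != 0 by apply: contraNneq Bw => Dw; rewrite EB hornerM Dw mulr0.
    by rewrite mulrAC [X in _ == X]mulrA (inj_eq (mulIf Dw)) => /eqP.
  have dv : B1 %| B'.
    by rewrite -(Gauss_dvdpr _ co) E dvdp_mull.
  have B1z : B1.[z] != 0.
    by apply: contraNneq B'z => B1z; rewrite -(divpK dv) hornerM B1z mulr0.
  split=> //; rewrite HF' //; apply/eqP; rewrite eqr_div // -!hornerM E.
  by rewrite mulrC.
have sB1 : size B1 == 1%N.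
  by apply/negPn/negP => /closed_rootP[z /rootP Bz]; have [] := key z; rewrite Bz eqxx.
have /size1_polyC EB1 : (size B1 <= 1)%N by rewrite (eqP sB1).
exists ((B1`_0)^-1 *: A1) => z; have [_ ->] := key z.
by rewrite hornerZ {1}EB1 hornerC mulrC.
Qed.

(** A pole of order at most [n] at infinity bounds the degree by [n]: compare
    the orders of vanishing at [0] after the substitution of [1/w]. *)
Lemma size_pole_at_infinity P n F : rational_at 0 F ->
  (forall w, w != 0 -> P.[w] = w ^+ n * F w^-1) -> (size P <= n.+1)%N.
Proof.
move=> [A [B [B0 HF]]] H; rewrite leqNgt; apply/negP => sP.
set d := (size P).-1.
have dP : size P = d.+1 by rewrite prednK // (leq_ltn_trans _ sP).
have nd : (n < d)%N by rewrite -ltnS -dP.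
(* [R] is the reversed polynomial, whose value at [0] is the leading
   coefficient of [P]. *)
pose R := \poly_(i < size P) P`_(d - i).
have RE w : w != 0 -> R.[w] = w ^+ d * P.[w^-1].
  move=> w0; rewrite horner_poly horner_coef dP mulr_sumr.
  rewrite (reindex_inj rev_ord_inj) /=; apply: eq_bigr => i _.
  have id : (i <= d)%N by rewrite -ltnS.
  rewrite subSS subKn // mulrCA; congr (_ * _).
  by rewrite exprVn; apply/eqP; rewrite -(inj_eq (mulIf (expf_neq0 i w0)))
    -exprD subnK // mulfVK ?expf_neq0.
have E : R * B = 'X^(d - n) * A.
  apply: (@poly_eq_off _ _ (B * 'X)); first by rewrite mulf_neq0 ?polyX_eq0 ?(horner_neq0 B0).
  move=> w; rewrite !hornerM hornerX hornerXn mulf_eq0 negb_or => /andP[Bw w0].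
  rewrite RE // H ?invr_eq0 // invrK HF //.
  rewrite -{1}(subnK (ltnW nd)) exprD exprVn !mulrA mulfVK //.
  by rewrite mulfK // expf_neq0.
move/(congr1 (fun Q => Q.[0])): E.
rewrite !hornerM hornerXn expr0n subn_eq0 leqNgt nd /= mul0r => /eqP.
rewrite mulf_eq0 (negPf B0) orbF horner_coef0 coef_poly dP /= subn0.
by rewrite -[d]/((size P).-1) -/(lead_coef P) lead_coef_eq0 -size_poly_eq0 dP.
Qed.

End Entire.

(** * Characters, charts and regular functions *)

Section Toric.
Variables (K : fieldType) (k n : nat) (Sigma : fan k n).
Implicit Types (m v : 'rV[int]_k) (tau : {set 'I_n}) (x y : tpoint K Sigma).

Lemma pairingDl m1 m2 v : pairing (m1 + m2) v = pairing m1 v + pairing m2 v.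
Proof. by rewrite /pairing -big_split; apply: eq_bigr => i _; rewrite mxE mulrDl. Qed.

Lemma pairing0l v : pairing 0 v = 0.
Proof. by rewrite /pairing big1 // => i _; rewrite mxE mul0r. Qed.

Lemma pairingNl m v : pairing (- m) v = - pairing m v.
Proof. by rewrite /pairing -sumrN; apply: eq_bigr => i _; rewrite mxE mulNr. Qed.

Lemma pairingBl m1 m2 v : pairing (m1 - m2) v = pairing m1 v - pairing m2 v.
Proof. by rewrite pairingDl pairingNl. Qed.

Lemma dual_coneP tau m :
  reflect (forall i, i \in tau -> 0 <= pairing m (ray Sigma i))
          (dual_cone Sigma tau m).
Proof. exact: forall_inP. Qed.

Lemma perp_coneP tau m :
  reflect (forall i, i \in tau -> pairing m (ray Sigma i) = 0)
          (perp_cone Sigma tau m).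
Proof. by apply: (iffP forall_inP) => H i /H /eqP. Qed.

Lemma perp_dual tau m : perp_cone Sigma tau m -> dual_cone Sigma tau m.
Proof. by move=> /perp_coneP H; apply/dual_coneP => i /H->. Qed.

Lemma dual_coneS tau tau' m : tau \subset tau' ->
  dual_cone Sigma tau' m -> dual_cone Sigma tau m.
Proof. by move=> /fintype.subsetP ss /dual_coneP H; apply/dual_coneP => i /ss/H. Qed.

Lemma perp_coneS tau tau' m : tau \subset tau' ->
  perp_cone Sigma tau' m -> perp_cone Sigma tau m.
Proof. by move=> /fintype.subsetP ss /perp_coneP H; apply/perp_coneP => i /ss/H. Qed.

Lemma dual_coneD tau m1 m2 : dual_cone Sigma tau m1 -> dual_cone Sigma tau m2 ->
  dual_cone Sigma tau (m1 + m2).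
Proof.
move=> /dual_coneP H1 /dual_coneP H2; apply/dual_coneP => i it.
by rewrite pairingDl addr_ge0 ?H1 ?H2.
Qed.

Lemma tpoint_ext x y : tcone x = tcone y -> tval x =1 tval y -> x = y.
Proof.
case: x y => [s v fs v0 vD vn] [s' v' fs' v0' vD' vn'] /= E /funext E'.
by subst; congr Tpoint; apply: Prop_irrelevance.
Qed.

Lemma is_coneS tau tau' : tau \subset tau' -> is_cone Sigma tau' -> is_cone Sigma tau.
Proof.
move=> ss /exists_inP[s ms ts]; apply/exists_inP; exists s => //.
exact: fintype.subset_trans ss ts.
Qed.

Lemma tact1 x : tact (torus1 K k) x = x.
Proof. by apply: tpoint_ext => // m /=; rewrite mul1r. Qed.

Lemma tactM (s t : torus K k) x : tact (torusM s t) x = tact s (tact t x).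
Proof. by apply: tpoint_ext => // m /=; rewrite mulrA. Qed.

Lemma tval_eq0 x m : ~~ perp_cone Sigma (tcone x) m -> tval x m = 0.
Proof. by rewrite -tval_neq0 negbK => /eqP. Qed.

Lemma tval_perp_sum (I : Type) (r : seq I) x (f : I -> 'rV[int]_k) :
  (forall i, perp_cone Sigma (tcone x) (f i)) ->
  tval x (\sum_(i <- r) f i) = \prod_(i <- r) tval x (f i).
Proof.
move=> H; elim: r => [|i r IH]; first by rewrite !big_nil tval0.
rewrite !big_cons tvalD ?IH //; first exact: perp_dual.
elim: (r) => [|j r' IH']; first by rewrite big_nil; apply/dual_coneP => l; rewrite pairing0l.
by rewrite big_cons dual_coneD // perp_dual.
Qed.

Lemma tval_perpV x m : perp_cone Sigma (tcone x) m -> tval x (- m) = (tval x m)^-1.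
Proof.
move=> pm; have nz : tval x m != 0 by rewrite tval_neq0.
apply: (mulIf nz); rewrite mulVf // -tvalD ?addNr ?tval0 //; last exact: perp_dual.
by apply/dual_coneP => i /(perp_coneP _ _ pm) E; rewrite pairingNl E.
Qed.

Lemma tval_perpMz x m (e : int) : perp_cone Sigma (tcone x) m ->
  tval x (m *~ e) = tval x m ^ e.
Proof.
move=> pm; have nat_case j : perp_cone Sigma (tcone x) (m *+ j) /\
    tval x (m *+ j) = tval x m ^+ j.
  elim: j => [|j [IH1 IH2]].
    by rewrite mulr0n tval0; split=> //; apply/perp_coneP => l; rewrite pairing0l.
  rewrite mulrS tvalD ?perp_dual // IH2 exprS; split=> //.
  apply/perp_coneP => l lx; rewrite pairingDl.
  by rewrite (perp_coneP _ _ pm) // (perp_coneP _ _ IH1).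
case: e => j; first by have [] := nat_case j.
by rewrite NegzE mulrNz tval_perpV ?(nat_case _).1 // (nat_case _).2.
Qed.

Lemma tfnS (c d : tchart Sigma) f : val d \subset val c ->
  tfn (K := K) c f -> tfn d f.
Proof.
move=> dc [r [a [m [H1 H2]]]]; exists r, a, m; split=> // l.
exact: dual_coneS (H1 l).
Qed.

Lemma tfn_tval (c : tchart Sigma) m : dual_cone Sigma (val c) m ->
  tfn c (fun x => tval x m).
Proof. by exists 1%N, (fun=> 1), (fun=> m); split=> // x; rewrite big_ord1 mul1r. Qed.

Lemma tfn_scale (c : tchart Sigma) a f : tfn (K := K) c f -> tfn c (fun x => a * f x).
Proof.
move=> [r [b [m [H1 H2]]]]; exists r, (fun l => a * b l), m; split=> // x.
by rewrite H2 mulr_sumr; apply: eq_bigr => l _; rewrite mulrA.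
Qed.

End Toric.

Section Regular.
Variables (K : fieldType) (X : prevariety K).
Implicit Types (c : chart X).

Lemma zopen_dom c : zopen (dom c).
Proof.
move=> x cx; exists 1%N, (fun=> c), (fun=> fun=> 1); split=> [_|_|z /(_ ord0) []//].
  exact: fn_cst.
by split=> //; apply: oner_neq0.
Qed.

Lemma regular_fn c f (U : set X) : fn c f -> U `<=` dom c -> regular U f.
Proof.
move=> cf Uc x /Uc cx; exists (dom c), c, f, (fun=> 1); split=> //.
- exact: zopen_dom.
- by split=> //; apply: fn_cst.
- by move=> y _ _; rewrite oner_neq0 divr1.
Qed.

End Regular.

(** * The fan and the affine charts of a Bott tower *)

Section BottCharts.
Variables (K : fieldType) (k : nat) (c : 'I_k -> 'I_k -> nat).
Implicit Types (s : 'I_k -> bool) (i j : 'I_k) (l : 'I_(k + k)) (m : 'rV[int]_k).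
Implicit Types (t : 'I_k -> K) (tau : {set 'I_(k + k)}).

Let Sigma := bott_fan c.
Let X := toric_variety K Sigma.

(** A maximal cone is encoded by the set of those [i] for which it contains
    [v_(k+i)] rather than [v_i]. *)
Definition bgen s i : 'I_(k + k) := if s i then rshift k i else lshift k i.
Definition bcone s : {set 'I_(k + k)} := [set bgen s i | i : 'I_k].
Definition bidx l : 'I_k := match split l with inl i => i | inr i => i end.

Lemma bidx_lshift i : bidx (lshift k i) = i.
Proof. by rewrite /bidx (unsplitK (inl i)). Qed.

Lemma bidx_rshift i : bidx (rshift k i) = i.
Proof. by rewrite /bidx (unsplitK (inr i)). Qed.

Lemma bgenK s : cancel (bgen s) bidx.
Proof. by move=> i; rewrite /bgen; case: (s i); rewrite ?bidx_rshift ?bidx_lshift. Qed.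

Lemma bidx_cases l : l = lshift k (bidx l) \/ l = rshift k (bidx l).
Proof. by rewrite /bidx; case: split_ordP => i ->; [left|right]. Qed.

Lemma mem_bcone s l : (l \in bcone s) = (l == bgen s (bidx l)).
Proof.
apply/imsetP/eqP => [[i _ ->]|->]; first by rewrite bgenK.
by exists (bidx l).
Qed.

Lemma bgen_cone s i : bgen s i \in bcone s.
Proof. exact: imset_f. Qed.

Lemma lshift_cone s i : (lshift k i \in bcone s) = ~~ s i.
Proof. by rewrite mem_bcone bidx_lshift /bgen; case: (s i); rewrite ?eqxx // eq_lrshift. Qed.

Lemma rshift_cone s i : (rshift k i \in bcone s) = s i.
Proof. by rewrite mem_bcone bidx_rshift /bgen; case: (s i); rewrite ?eqxx // eq_rlshift. Qed.

Lemma bcone_max s : bcone s \in maxcones Sigma.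
Proof. by rewrite inE; apply/forallP => i; rewrite lshift_cone rshift_cone; case: (s i). Qed.

(** The maximal cone in which the rays outside [tau] are chosen among the
    [v_i]. *)
Definition bhome (tau : {set 'I_(k + k)}) : 'I_k -> bool := fun i => rshift k i \in tau.

Lemma bhome_sub tau : is_cone Sigma tau -> tau \subset bcone (bhome tau).
Proof.
move=> /exists_inP[S]; rewrite inE => /forallP xS /fintype.subsetP tS.
apply/fintype.subsetP => l lt; have [E|E] := bidx_cases l; rewrite E in lt *.
  rewrite lshift_cone /bhome; apply/negP => rt.
  by have := xS (bidx l); rewrite (tS _ lt) (tS _ rt).
by rewrite rshift_cone.
Qed.

Lemma sub_bcone_is_cone s tau : tau \subset bcone s -> is_cone Sigma tau.
Proof. by move=> H; apply/exists_inP; exists (bcone s) => //; apply: bcone_max. Qed.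

Definition bchart s : tchart Sigma := Sub (bcone s) (sub_bcone_is_cone (subxx _)).

Lemma pairing_bray m s i : pairing m (ray Sigma (bgen s i)) =
  if s i then - m 0 i + \sum_(j < k | (i < j)%N) m 0 j * (c i j)%:Z else m 0 i.
Proof.
have pdelta j : \sum_l m 0 l * (delta_mx 0 j : 'rV[int]_k) 0 l = m 0 j.
  rewrite (bigD1 j) //= mxE !eqxx mulr1 big1 ?addr0 // => l lj.
  by rewrite mxE (negPf lj) andbF mulr0.
rewrite /pairing /= /bott_ray /bgen; case: (s i).
  rewrite (unsplitK (inr i)).
  under eq_bigr => l _ do rewrite mxE mulrDr mxE mulrN summxE mulr_sumr.
  rewrite big_split /= sumrN pdelta exchange_big /=; congr (_ + _).
  apply: eq_bigr => j _.
  under eq_bigr => l _ do rewrite mulmxnE mulrnAr.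
  by rewrite sumrMnl pdelta -mulr_natr natz.
by rewrite (unsplitK (inl i)) pdelta.
Qed.

Lemma sum_above m (f : 'I_k -> int) i : (forall j, (i < j)%N -> m 0 j = 0) ->
  \sum_(j < k | (i < j)%N) m 0 j * f j = 0.
Proof. by move=> H; apply: big1 => j /H ->; rewrite mul0r. Qed.

(** The generators are triangular with diagonal entries [1] or [-1], so the
    coordinates can be computed from the pairings, starting with the last. *)
Lemma coord_above_eq0 m s i :
  (forall j, (i < j)%N -> pairing m (ray Sigma (bgen s j)) = 0) ->
  forall j, (i < j)%N -> m 0 j = 0.
Proof.
move=> H j; have [d] := ubnP (k - j); elim: d j => // d IH j dj ij.
have Hj : forall l : 'I_k, (j < l)%N -> m 0 l = 0.
  move=> l jl; apply: IH; last exact: ltn_trans ij jl.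
  by rewrite ltnS in dj; apply: leq_trans dj; rewrite ltn_sub2l.
have := H j ij; rewrite pairing_bray sum_above // addr0.
by case: (s j) => // /eqP; rewrite oppr_eq0 => /eqP.
Qed.

Lemma coord_eq0 m s : (forall j, pairing m (ray Sigma (bgen s j)) = 0) -> m = 0.
Proof.
move=> H; apply/rowP => j; rewrite mxE.
have Hj : forall l : 'I_k, (j < l)%N -> m 0 l = 0 by apply: (@coord_above_eq0 _ s).
have := H j; rewrite pairing_bray sum_above // addr0.
by case: (s j) => // /eqP; rewrite oppr_eq0 => /eqP.
Qed.

Lemma pairing_top m s s' i :
  (forall j, (i < j)%N -> pairing m (ray Sigma (bgen s j)) = 0) ->
  pairing m (ray Sigma (bgen s' i)) = (-1) ^+ (s' i) * m 0 i.
Proof.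
move=> /coord_above_eq0 H; rewrite pairing_bray sum_above // addr0.
by case: (s' i); rewrite ?mul1r ?mulN1r.
Qed.

Definition bmx s : 'M[int]_k := \matrix_(i, j) ray Sigma (bgen s j) 0 i.

Lemma mul_bmx m s i : (m *m bmx s) 0 i = pairing m (ray Sigma (bgen s i)).
Proof. by rewrite !mxE /pairing; apply: eq_bigr => j _; rewrite mxE. Qed.

Lemma bmx_entry s i j : bmx s i j = pairing (delta_mx 0 i) (ray Sigma (bgen s j)).
Proof. by rewrite -mul_bmx -rowE [RHS]mxE. Qed.

Lemma bmx_unit s : bmx s \in unitmx.
Proof.
have entry i j : (i <= j)%N -> bmx s i j = if i == j then (-1) ^+ s j else 0.
  move=> ij; rewrite bmx_entry pairing_bray !mxE eqxx /= eq_sym.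
  rewrite sum_above ?addr0; last first.
    move=> l jl; rewrite mxE eqxx /=.
    by rewrite -val_eqE /= gtn_eqF // (leq_ltn_trans ij jl).
  by case: (s j); case: (i == j); rewrite ?oppr0.
have tr : is_trig_mx (bmx s).
  apply/is_trig_mxP => i j ij; rewrite entry ?(ltnW ij) //.
  by rewrite -val_eqE /= ltn_eqF.
rewrite unitmxE (det_trig tr) rpred_prod // => i _.
by rewrite entry // eqxx unitrX // unitrN unitr1.
Qed.

(** The matrix of generators is unimodular; the rows of its inverse form the
    basis dual to the generators of [bcone s]. *)
Definition bdual s i : 'rV[int]_k := row i (invmx (bmx s)).

Lemma pairing_bdual s i j : pairing (bdual s i) (ray Sigma (bgen s j)) = (i == j)%:Z.
Proof. by rewrite -mul_bmx /bdual -row_mul mulVmx ?bmx_unit // !mxE; case: eqP. Qed.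

Lemma bdual_expand s m : m = \sum_i bdual s i *~ pairing m (ray Sigma (bgen s i)).
Proof.
apply/subr0_eq/(@coord_eq0 _ s) => j; rewrite pairingBl.
suff -> : pairing (\sum_i bdual s i *~ pairing m (ray Sigma (bgen s i)))
    (ray Sigma (bgen s j)) = pairing m (ray Sigma (bgen s j)) by rewrite subrr.
rewrite -mul_bmx mulmx_suml summxE (bigD1 j) //= big1 => [|i ij].
  rewrite addr0 -scaler_int -scalemxAl mxE mul_bmx pairing_bdual eqxx intz.
  by rewrite mulr1.
by rewrite -scaler_int -scalemxAl mxE mul_bmx pairing_bdual (negPf ij) mulr0.
Qed.

Definition bptcone s t : {set 'I_(k + k)} := [set bgen s i | i in [pred i | t i == 0]].

Lemma bptconeP s t l : reflect (exists2 i, t i = 0 & l = bgen s i) (l \in bptcone s t).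
Proof.
apply: (iffP imsetP) => -[i0].
  by rewrite inE => /eqP ti ->; exists i0.
by move=> ti ->; exists i0; rewrite ?inE ?ti.
Qed.

Lemma bgen_bptcone s t i : (bgen s i \in bptcone s t) = (t i == 0).
Proof.
apply/bptconeP/eqP => [[j tj /(congr1 bidx)]|ti]; last by exists i.
by rewrite !bgenK => ->.
Qed.

Lemma bptcone_sub s t : bptcone s t \subset bcone s.
Proof. by apply/fintype.subsetP => l /bptconeP[i _ ->]; apply: bgen_cone. Qed.

Definition bptval s t m : K := \prod_i t i ^ pairing m (ray Sigma (bgen s i)).

Lemma bptval_neq0 s t m :
  (bptval s t m != 0) = perp_cone Sigma (bptcone s t) m.
Proof.
apply/prodf_neq0/perp_coneP => [H l /bptconeP[j tj ->]|H j _].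
  have := H j isT; rewrite expfz_eq0 tj eqxx andbT negbK => /eqP; exact.
rewrite expfz_eq0 negb_and negbK.
have [tj|_] := eqVneq (t j) 0; last exact: orbT.
by rewrite H ?eqxx // bgen_bptcone tj.
Qed.

Lemma bptvalD s t m1 m2 :
  dual_cone Sigma (bptcone s t) m1 -> dual_cone Sigma (bptcone s t) m2 ->
  bptval s t (m1 + m2) = bptval s t m1 * bptval s t m2.
Proof.
move=> /dual_coneP H1 /dual_coneP H2; rewrite /bptval -big_split.
apply: eq_bigr => i _; rewrite pairingDl.
have [ti|ti] := eqVneq (t i) 0; last by rewrite expfzDr.
by rewrite exprzD_ss // H1 ?H2 // bgen_bptcone; apply/eqP.
Qed.

Lemma bptval0 s t : bptval s t 0 = 1.
Proof. by rewrite /bptval big1 // => i _; rewrite pairing0l expr0z. Qed.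

(** The chart of a smooth maximal cone is an affine space.  The convention that
    [0 ^ n] is [0] for every nonzero integer [n] makes the product of powers
    vanish exactly on the characters that do not lie in [perp_cone]. *)
Definition bpt s t : X :=
  Tpoint (sub_bcone_is_cone (bptcone_sub s t)) (bptval0 s t)
    (@bptvalD s t) (bptval_neq0 s t).

Lemma bpt_ext s t t' : t =1 t' -> bpt s t = bpt s t'.
Proof. by move=> /funext->. Qed.

Definition bcoord s (x : X) i : K := tval x (bdual s i).

Lemma bgen_tcone s (x : X) i : tcone x \subset bcone s ->
  (bgen s i \in tcone x) = (bcoord s x i == 0).
Proof.
move=> /fintype.subsetP xs; rewrite /bcoord; apply/idP/idP => H.
  apply/eqP/tval_eq0/perp_coneP => /(_ _ H).
  by rewrite pairing_bdual eqxx.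
apply/negPn/negP => ix; move: H; apply/negP; rewrite tval_neq0.
apply/perp_coneP => l lx.
have := xs _ lx; rewrite mem_bcone => /eqP E; rewrite E pairing_bdual.
by case: eqP => // Ei; rewrite Ei -E lx in ix.
Qed.

Lemma bcoordK s (x : X) : tcone x \subset bcone s -> bpt s (bcoord s x) = x.
Proof.
move=> xs; have Ec : bptcone s (bcoord s x) = tcone x.
  apply/setP => l; apply/bptconeP/idP => [[i /eqP + ->]|lx].
    by rewrite -bgen_tcone.
  have := fintype.subsetP xs _ lx; rewrite mem_bcone => /eqP E.
  by exists (bidx l) => //; apply/eqP; rewrite -bgen_tcone // -E.
apply: tpoint_ext => // m /=.
(* Both sides vanish off [perp_cone]; on it, [m] is expanded in the dual
   basis and the values of [x] are invertible. *)
have [pm|pm] := boolP (perp_cone Sigma (tcone x) m); last first.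
  by rewrite tval_eq0 //; apply/eqP; rewrite -[_ == _]negbK bptval_neq0 Ec.
have pi i : perp_cone Sigma (tcone x) (bdual s i *~ pairing m (ray Sigma (bgen s i))).
  apply/perp_coneP => l lx.
  have := fintype.subsetP xs _ lx; rewrite mem_bcone => /eqP E.
  rewrite E -mul_bmx -scaler_int -scalemxAl mxE mul_bmx pairing_bdual.
  case: eqP => [->|_]; last by rewrite mulr0.
  by rewrite -E (perp_coneP _ _ _ pm).
rewrite [in RHS](bdual_expand s m) tval_perp_sum //; apply: eq_bigr => i _.
have [ix|ix] := boolP (bgen s i \in tcone x).
  by rewrite (perp_coneP _ _ _ pm) // mulr0z tval0 expr0z.
rewrite tval_perpMz //; apply/perp_coneP => l lx.
have := fintype.subsetP xs _ lx; rewrite mem_bcone => /eqP E.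
by rewrite E pairing_bdual; case: eqP => // Ei; rewrite Ei -E lx in ix.
Qed.

Definition bflip s i : 'I_k -> bool := fun j => if j == i then ~~ s i else s j.
Definition binv t i : 'I_k -> K := fun j => if j == i then (t i)^-1 else t j.

Lemma bgen_flip s i j : j != i -> bgen (bflip s i) j = bgen s j.
Proof. by rewrite /bgen /bflip => /negPf->. Qed.

(** Passing through infinity in the [i]-th coordinate.  A character that does
    not vanish at a point whose later coordinates are all zero pairs to zero
    with the later generators, hence has no later coordinates, and on such a
    character [v_i] and [v_(k+i)] are opposite.  The other coordinates are thus
    unchanged, whatever the Bott numbers are. *)
Lemma bpt_flip s t i : t i != 0 -> (forall j, (i < j)%N -> t j = 0) ->
  bpt (bflip s i) (binv t i) = bpt s t.
Proof.
move=> ti tj; apply: tpoint_ext => [|m] /=.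
  apply/setP => l; apply/bptconeP/bptconeP => -[j].
    rewrite /binv; have [->|ji tj0 ->] := eqVneq j i.
      by move/eqP; rewrite invr_eq0 (negPf ti).
    by exists j => //; rewrite bgen_flip.
  have [->|ji tj0 ->] := eqVneq j i; first by move/eqP; rewrite (negPf ti).
  by exists j; rewrite ?bgen_flip // /binv (negPf ji).
have [/forallP H|/forallPn[j]] := boolP
  [forall j : 'I_k, (i < j)%N ==> (pairing m (ray Sigma (bgen s j)) == 0)].
  rewrite /bptval; apply: eq_bigr => j _; rewrite /binv.
  have [->|ji] := eqVneq j i; last by rewrite bgen_flip.
  have Hs j' : (i < j')%N -> pairing m (ray Sigma (bgen s j')) = 0.
    by move=> ij; have /implyP/(_ ij)/eqP := H j'.
  rewrite !(pairing_top (s := s)) // /bflip eqxx.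
  by case: (s i); rewrite /= ?mul1r ?mulN1r ?exprz_inv ?opprK.
rewrite negb_imply => /andP[ij pj]; have ji : j != i.
  by rewrite -val_eqE /= gtn_eqF.
rewrite /bptval (bigD1 j) //= [RHS](bigD1 j) //= bgen_flip //.
by rewrite /binv (negPf ji) tj // exp0rz (negPf pj) !mul0r.
Qed.

End BottCharts.

(** * Restriction to polynomial curves in a chart *)

Section Curves.
Variables (K : fieldType) (k : nat) (c : 'I_k -> 'I_k -> nat).
Let Sigma := bott_fan c.
Let X := toric_variety K Sigma.
Implicit Types (s : 'I_k -> bool) (T : 'I_k -> {poly K}) (U : set X) (z : K).

Definition bcurve s T (z : K) : X := bpt c s (fun i => (T i).[z]).

(** Leaving the chart of [tau] requires some coordinate that is nonzero at [z]
    to vanish, which happens for finitely many parameters only. *)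
Lemma bcurve_dom s T z (tau : {set 'I_(k + k)}) : tcone (bcurve s T z) \subset tau ->
  znear z (fun w => tcone (bcurve s T w) \subset tau).
Proof.
move=> /fintype.subsetP zt.
pose P i w := bgen s i \notin tau -> (T i).[w] != 0.
have near_P i : znear z (P i).
  have [it|it] := boolP (bgen s i \in tau).
    by apply: znearT => w; rewrite /P it; case/negP.
  have Tz : (T i).[z] != 0.
    by apply: contraNneq it => Tz; apply: zt; rewrite bgen_bptcone Tz.
  by apply: znearS (znear_poly Tz) => w Tw _.
apply: znearS (znear_all near_P) => w Pw.
apply/fintype.subsetP => l /bptconeP[i Ti ->].
by apply/negPn/negP => /Pw; rewrite Ti eqxx.
Qed.

(** Negative exponents only occur at coordinates that do not vanish at [z]. *)
Lemma bcurve_tval s T z (tau : {set 'I_(k + k)}) m :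
  tcone (bcurve s T z) \subset tau -> dual_cone Sigma tau m ->
  rational_at z (fun w => tval (bcurve s T w) m).
Proof.
move=> zt /(dual_coneS zt)/dual_coneP dm; apply: rational_at_prod => i.
apply: rational_atXz; last exact: rational_at_poly.
have [Tz|Tz] := eqVneq (T i).[z] 0; last by right.
by left; apply: dm; rewrite bgen_bptcone Tz.
Qed.

Lemma bcurve_fn s T z (d : tchart Sigma) f : dom (p := X) d (bcurve s T z) ->
  fn (p := X) d f -> rational_at z (fun w => f (bcurve s T w)).
Proof.
move=> zd [r [a [m [dm E]]]].
apply: rational_at_ext (fun w => esym (E (bcurve s T w))) _.
apply: rational_at_sum => l; apply: rational_atM; first exact: rational_at_cst.
exact: bcurve_tval (dm l).
Qed.

Lemma bcurve_open s T z U : zopen U -> U (bcurve s T z) ->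
  znear z (fun w => U (bcurve s T w)).
Proof.
move=> oU /oU[n [d [f [ff fz UU]]]].
have near_l l : znear z (fun w => basic_open (d l) (f l) (bcurve s T w)).
  have [dz nz] := fz l; apply: znear_and; first exact: bcurve_dom.
  by apply: znear_neq0 nz; apply: bcurve_fn dz (ff l).
by apply: znearS (znear_all near_l) => w; apply: UU.
Qed.

Lemma bcurve_regular s T z U F : zopen U -> regular U F -> U (bcurve s T z) ->
  rational_at z (fun w => F (bcurve s T w)).
Proof.
move=> oU rF Uz; have [W [d [f [g [oW Wz Wd [ff gg] H]]]]] := rF _ Uz.
have [gz _] := H _ Uz Wz.
apply: (@rational_at_near _ _ (fun w => f (bcurve s T w) / g (bcurve s T w))).
  apply: znearS (znear_and (bcurve_open oU Uz) (bcurve_open oW Wz)) => w [Uw Ww].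
  by have [_ ->] := H _ Uw Ww.
apply: rational_atM; first by apply: bcurve_fn ff; apply: Wd.
by apply: rational_atV => //; apply: bcurve_fn gg; apply: Wd.
Qed.

Lemma bcurve_regular_mx s T z U m n (A : X -> 'M[K]_(m, n)) : zopen U ->
  regular_mx U A -> U (bcurve s T z) -> rational_mx z (fun w => A (bcurve s T w)).
Proof. by move=> oU rA Uz i j; apply: bcurve_regular (rA i j) Uz. Qed.

End Curves.

(** * Local equations of the invariant divisors *)

Section Divisors.
Variables (K : closedFieldType) (k : nat) (c : 'I_k -> 'I_k -> nat).
Let Sigma := bott_fan c.
Let X := toric_variety K Sigma.
Implicit Types (s : 'I_k -> bool) (x y : X) (U V W : set X) (l : 'I_(k + k)).

(** A point whose cone contains [l] is the limit, along a curve in a chart, of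
    points whose cone is the ray [l]: perturb all its other vanishing
    coordinates. *)
Lemma tdivisorP l x : tdivisor (Sigma := Sigma) l x <-> l \in tcone x.
Proof.
split=> [cx|lx].
  pose d : tchart Sigma := Sub (tcone x) (tcone_fan x).
  have [||y yl] := cx (dom (p := X) d); first exact: zopen_dom.
    exact: subxx.
  by rewrite /dom /= /tdomain /= yl finset.sub1set.
move=> U oU Ux; have xs := bhome_sub (tcone_fan x).
set s := bhome (tcone x) in xs; set t := bcoord s x.
have El : l = bgen s (bidx l).
  by apply/eqP; rewrite -mem_bcone; apply: (fintype.subsetP xs).
set j := bidx l in El.
pose T i : {poly K} := if i == j then 0 else if t i == 0 then 'X else (t i)%:P.
have T0 : bcurve c s T 0 = x.
  rewrite -[RHS](bcoordK xs); apply: bpt_ext => i; rewrite /T.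
  have [->|_] := eqVneq i j.
    by rewrite horner0; apply/esym/eqP; rewrite -bgen_tcone // -El.
  by case: eqP => [ti|_]; rewrite ?hornerX ?hornerC // -ti.
have [B B0 HB] : znear 0 (fun w => U (bcurve c s T w)).
  by apply: bcurve_open => //; rewrite T0.
have [w] := @poly_nonroot K (B * 'X) (mulf_neq0 (horner_neq0 B0) (negbT (polyX_eq0 _))).
rewrite hornerM hornerX mulf_eq0 negb_or => /andP[/HB Uw w0].
exists (bcurve c s T w) => //; apply/setP => l'; rewrite finset.in_set1.
apply/bptconeP/eqP => [[i + ->]|->].
  rewrite /T; have [->//|_] := eqVneq i j.
  by case: eqP => [_|ti]; rewrite ?hornerX ?hornerC => /eqP; rewrite ?(negPf w0) // => /eqP.
by exists j; rewrite // /T eqxx horner0.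
Qed.

(** A function on a chart that vanishes on the divisor is divisible by the
    character cutting it out: the monomials of [f] that pair positively with the
    generator are divisible, and the sum of the others is unchanged when a point
    is projected onto the divisor, hence vanishes. *)
Lemma tfn_divide s j (d : tchart Sigma) f :
  val d \subset bcone s -> bgen s j \in val d -> fn (p := X) d f ->
  (forall x, dom (p := X) d x -> bgen s j \in tcone x -> f x = 0) ->
  exists2 g, fn (p := X) d g & forall x, dom (p := X) d x -> f x = tval x (bdual c s j) * g x.
Proof.
move=> ds jd [r [a [m [dm E]]]] f0.
pose pos i := 0 < pairing (m i) (ray Sigma (bgen s j)).
pose m' i := if pos i then m i - bdual c s j else 0.
have dm' i : dual_cone Sigma (val d) (m' i).
  apply/dual_coneP => l ld; rewrite /m'; case: ifP => pi; last by rewrite pairing0l.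
  have := fintype.subsetP ds _ ld; rewrite mem_bcone => /eqP El.
  rewrite pairingBl [in X in _ - X]El pairing_bdual subr_ge0.
  have [ji|_] := eqVneq j (bidx l); last by apply: (dual_coneP _ _ _ (dm i)).
  by move: pi; rewrite /pos El -ji gtz0_ge1.
exists (fun x => \sum_(i < r) (if pos i then a i else 0) * tval x (m' i)).
  by exists r, (fun i => if pos i then a i else 0), m'.
move=> x dx; have xs := fintype.subset_trans dx ds.
(* The projection of [x] onto the divisor. *)
pose t i := if i == j then 0 else bcoord s x i.
have tx : dom (p := X) d (bpt c s t).
  apply/fintype.subsetP => l /bptconeP[i' + ->]; rewrite /t.
  have [->//|_ /eqP] := eqVneq i' j; rewrite -bgen_tcone //.
  exact: fintype.subsetP.
have f0t : f (bpt c s t) = 0 by apply: f0 => //; rewrite bgen_bptcone /t eqxx.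
have -> : f x = f x - f (bpt c s t) by rewrite f0t subr0.
rewrite !E -sumrB /= mulr_sumr; apply: eq_bigr => i _.
rewrite mulrCA -mulrBr.
have Ex : tval x (m i) = tval (bpt c s (bcoord s x)) (m i) by rewrite bcoordK.
case: ifP => pi; last first.
  rewrite mul0r; apply/eqP; rewrite mulf_eq0 subr_eq0 Ex; apply/orP; right.
  apply/eqP/eq_bigr => i' _; rewrite /t; have [->|//] := eqVneq i' j.
  suff -> : pairing (m i) (ray Sigma (bgen s j)) = 0 by rewrite !expr0z.
  apply/eqP; rewrite eq_le leNgt -/(pos i) pi /=.
  exact: (dual_coneP _ _ _ (dm i)).
congr (_ * _).
have -> : bptval c s t (m i) = 0.
  by rewrite /bptval (bigD1 j) //= /t eqxx exp0rz gt_eqF // mul0r.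
have Em : m i = bdual c s j + (m i - bdual c s j) by rewrite addrC subrK.
rewrite subr0 /m' pi {1}Em tvalD //.
  apply/dual_coneP => l lx; have := fintype.subsetP xs _ lx.
  by rewrite mem_bcone => /eqP El; rewrite El pairing_bdual; case: eqP.
have := dm' i; rewrite /m' pi; apply: dual_coneS; exact: dx.
Qed.

(** The divisor is irreducible: two of its points in a chart are joined by an
    affine line of the chart, which lies in the divisor. *)
Lemma vanish_on_divisor s j (d : tchart Sigma) f U x y :
  val d \subset bcone s -> fn (p := X) d f -> zopen U ->
  U x -> bgen s j \in tcone x -> dom (p := X) d x ->
  (forall y, U y -> dom (p := X) d y -> bgen s j \in tcone y -> f y = 0) ->
  dom (p := X) d y -> bgen s j \in tcone y -> f y = 0.
Proof.
move=> ds ff oU Ux jx dx f0 dy jy.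
have xs := fintype.subset_trans dx ds; have ys := fintype.subset_trans dy ds.
pose T i : {poly K} := (bcoord s x i)%:P + (bcoord s y i - bcoord s x i) *: 'X.
have T0 : bcurve c s T 0 = x.
  rewrite -[RHS](bcoordK xs); apply: bpt_ext => i.
  by rewrite /T hornerD hornerZ hornerC hornerX mulr0 addr0.
have T1 : bcurve c s T 1 = y.
  rewrite -[RHS](bcoordK ys); apply: bpt_ext => i.
  by rewrite /T hornerD hornerZ hornerC hornerX mulr1 addrC subrK.
have jT w : bgen s j \in tcone (bcurve c s T w).
  rewrite bgen_bptcone /T.
  have -> : bcoord s x j = 0 by apply/eqP; rewrite -bgen_tcone.
  have -> : bcoord s y j = 0 by apply/eqP; rewrite -bgen_tcone.
  by rewrite subrr scale0r addr0 horner0.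
have [B B0 HB] : znear 0 (fun w => U (bcurve c s T w) /\ dom (p := X) d (bcurve c s T w)).
  apply: znear_and; first by apply: bcurve_open => //; rewrite T0.
  by apply: bcurve_dom; rewrite T0.
rewrite -T1; apply: (@rational_at_unique _ _ (fun w => f (bcurve c s T w)) (fun=> 0) B).
- by apply: bcurve_fn ff; rewrite T1.
- exact: rational_at_cst.
- exact: horner_neq0 B0.
- by move=> w /HB[Uw dw]; apply: f0.
Qed.

(** [e] is the value at [y] of a local quotient of [g] by the character
    [bdual s j].  On the divisor the values of [g] and of the character do not
    determine [e]; that all local quotients give the same value there is
    [divided_unique]. *)
Definition divided s j V (g : X -> K) y (e : K) :=
  exists W (d : tchart Sigma) (f1 f2 : X -> K),
    [/\ zopen W /\ W y, val d \subset bcone s /\ W `<=` dom (p := X) d,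
        fn (p := X) d f1 /\ fn (p := X) d f2, e = f1 y / f2 y
      & forall z, V z -> W z ->
          f2 z != 0 /\ g z = tval z (bdual c s j) * (f1 z / f2 z)].

Lemma divided_exists s j V g y : zopen V -> V `<=` dom (p := X) (bchart c s) ->
  regular V g -> (forall z, V z -> bgen s j \in tcone z -> g z = 0) -> V y ->
  exists e, divided s j V g y e.
Proof.
move=> oV Vs rg g0 Vy.
have [W [d [f1 [f2 [oW Wy Wd [ff1 ff2] H]]]]] := rg y Vy.
(* The chart [d] of the local quotient is arbitrary; below the chart of [s]
   the character [bdual s j] is regular. *)
pose ds := val d :&: bcone s.
have cds : is_cone Sigma ds by apply: is_coneS (finset.subsetIl _ _) (valP d).
have [jy|jy] := boolP (bgen s j \in tcone y).
  pose d' : tchart Sigma := Sub ds cds.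
  have dd' : val d' \subset val d by apply: finset.subsetIl.
  have ds' : val d' \subset bcone s by apply: finset.subsetIr.
  have VW z : V z -> W z -> dom (p := X) d' z.
    by move=> Vz Wz; rewrite /dom /= /tdomain /= finset.subsetI Wd //=; apply: Vs.
  have [h fh Eh] : exists2 h, fn (p := X) d' h &
      forall x, dom (p := X) d' x -> f1 x = tval x (bdual c s j) * h x.
    apply: tfn_divide => //.
    - by apply: fintype.subsetP jy; apply: VW.
    - exact: tfnS dd' ff1.
    move=> x dx jx; apply: (@vanish_on_divisor s j d' f1 (V `&` W) y) => //.
    - exact: tfnS dd' ff1.
    - exact: zopenI.
    - exact: VW.
    move=> z [Vz Wz] dz jz; have [f2z gz] := H z Vz Wz.
    move: (g0 z Vz jz); rewrite gz => /eqP.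
    by rewrite mulf_eq0 invr_eq0 (negPf f2z) orbF => /eqP.
  exists (h y / f2 y), (W `&` dom (p := X) d'), d', h, f2; split=> //.
  - by split; [apply: zopenI oW _; apply: zopen_dom|split=> //; exact: VW].
  - by split=> //; exact: tfnS dd' ff2.
  - move=> z Vz [Wz dz]; have [f2z gz] := H z Vz Wz; split=> //.
    by rewrite gz Eh // mulrA.
(* Off the divisor the character is invertible. *)
have cd' : is_cone Sigma (ds :\ bgen s j) by apply: is_coneS cds; apply: finset.subD1set.
pose d' : tchart Sigma := Sub (ds :\ bgen s j) cd'.
have dd' : val d' \subset val d.
  by apply: fintype.subset_trans (finset.subD1set _ _) (finset.subsetIl _ _).
have ds' : val d' \subset bcone s.
  by apply: fintype.subset_trans (finset.subD1set _ _) (finset.subsetIr _ _).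
have dy : dom (p := X) d' y.
  rewrite /dom /= /tdomain /= finset.subsetD1 jy andbT finset.subsetI Wd //=; exact: Vs.
have pu : perp_cone Sigma (val d') (bdual c s j).
  apply/perp_coneP => l; rewrite !inE => /andP[lj /andP[_ ls]].
  move: ls; rewrite mem_bcone => /eqP El; rewrite [in LHS]El pairing_bdual.
  by case: eqP => // ji; move: lj; rewrite El -ji eqxx.
have [h fh Eh] : exists2 h, fn (p := X) d' h &
    forall z, dom (p := X) d' z -> f1 z = tval z (bdual c s j) * h z.
  have [r [a [m [dm E]]]] := tfnS dd' ff1.
  exists (fun z => \sum_(i < r) a i * tval z (m i - bdual c s j)).
    exists r, a, (fun i => m i - bdual c s j); split=> // i.
    apply/dual_coneP => l ld.
    by rewrite pairingBl (perp_coneP _ _ _ pu) // subr0 (dual_coneP _ _ _ (dm i)).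
  move=> z dz; rewrite E mulr_sumr; apply: eq_bigr => i _.
  have Em : m i = bdual c s j + (m i - bdual c s j) by rewrite addrC subrK.
  rewrite mulrCA {1}Em tvalD //; first exact: perp_dual (perp_coneS dz pu).
  apply/dual_coneP => l lz; have ld := fintype.subsetP dz _ lz.
  by rewrite pairingBl (perp_coneP _ _ _ pu) // subr0 (dual_coneP _ _ _ (dm i)).
exists (h y / f2 y), (W `&` dom (p := X) d'), d', h, f2; split=> //.
- by split; [apply: zopenI oW _; apply: zopen_dom|].
- by split=> //; exact: tfnS dd' ff2.
- move=> z Vz [Wz dz]; have [f2z gz] := H z Vz Wz; split=> //.
  by rewrite gz Eh // mulrA.
Qed.

(** Any two local quotients agree off the divisor, hence, moving off it along a
    coordinate line, also on it. *)
Lemma divided_unique s j V g y e e' : zopen V -> V y ->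
  divided s j V g y e -> divided s j V g y e' -> e = e'.
Proof.
move=> oV Vy [W [d [f1 [f2 [[oW Wy] [ds Wd] [ff1 ff2] -> H]]]]].
move=> [W' [d' [f1' [f2' [[oW' Wy'] [ds' Wd'] [ff1' ff2'] -> H']]]]].
have ys : tcone y \subset bcone s by apply: fintype.subset_trans (Wd _ Wy) ds.
pose T i : {poly K} := (bcoord s y i)%:P + (if i == j then 'X else 0).
have T0 : bcurve c s T 0 = y.
  rewrite -[RHS](bcoordK ys); apply: bpt_ext => i.
  by rewrite /T hornerD hornerC; case: eqP; rewrite ?hornerX ?horner0 addr0.
have ratio (dd : tchart Sigma) (F1 F2 : X -> K) : dom (p := X) dd y ->
    fn (p := X) dd F1 -> fn (p := X) dd F2 -> F2 y != 0 ->
    rational_at 0 (fun w => F1 (bcurve c s T w) / F2 (bcurve c s T w)).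
  move=> dy fF1 fF2 nz; apply: rational_atM; first by apply: bcurve_fn fF1; rewrite T0.
  by apply: rational_atV; [rewrite T0|apply: bcurve_fn fF2; rewrite T0].
have [[nz _] [nz' _]] := (H _ Vy Wy, H' _ Vy Wy').
pose F w := f1 (bcurve c s T w) / f2 (bcurve c s T w).
pose F' w := f1' (bcurve c s T w) / f2' (bcurve c s T w).
suff: F 0 = F' 0 by rewrite /F /F' T0.
have [B B0 HB] : znear 0 (fun w => V (bcurve c s T w) /\
    (W (bcurve c s T w) /\ W' (bcurve c s T w))).
  by do 2?apply: znear_and; apply: bcurve_open; rewrite ?T0.
apply: (@rational_at_unique _ _ F F' (B * T j)).
- exact: ratio (Wd _ Wy) ff1 ff2 nz.
- exact: ratio (Wd' _ Wy') ff1' ff2' nz'.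
- rewrite mulf_neq0 ?(horner_neq0 B0) // /T eqxx addrC.
  by rewrite -size_poly_gt0 size_XaddC.
move=> w; rewrite hornerM mulf_eq0 negb_or => /andP[/HB[Vw [Ww Ww']] Tw].
have [_ gw] := H _ Vw Ww; have [_] := H' _ Vw Ww'; rewrite gw => /mulfI; apply.
rewrite tval_neq0; apply/perp_coneP => l /bptconeP[i Ti ->].
by rewrite pairing_bdual; case: eqP => // ji; move: Tw; rewrite ji Ti eqxx.
Qed.

Lemma local_equation_bdual s j :
  local_equation (tdivisor (Sigma := Sigma) (bgen s j))
    (dom (p := X) (bchart c s)) (fun x => tval x (bdual c s j)).
Proof.
have jc (x : X) : tcone x \subset bcone s ->
    (bgen s j \in tcone x) = (tval x (bdual c s j) == 0) by apply: bgen_tcone.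
split.
  apply: (@regular_fn _ X (bchart c s)) => //; apply: tfn_tval.
  apply/dual_coneP => l; rewrite /= mem_bcone => /eqP ->.
  by rewrite pairing_bdual; case: eqP.
move=> V g oV Vs rg; split=> [g0|[h rh Eh] y Vy /tdivisorP]; last first.
  by rewrite Eh // jc ?(Vs _ Vy) // => /eqP->; rewrite mul0r.
have ex y : exists e, V y -> divided s j V g y e.
  have [Vy|nVy] := pselect (V y); last by exists 0.
  have [|e He] := @divided_exists s j V g y oV Vs rg _ Vy; last by exists e.
  by move=> z Vz jz; apply: g0 => //; apply/tdivisorP.
pose h y := sval (cid (ex y)).
have hP y : V y -> divided s j V g y (h y) by rewrite /h; case: cid.
have key y : V y -> exists W (d : tchart Sigma) (f1 f2 : X -> K),
    [/\ zopen W, W y, W `<=` dom (p := X) d, fn (p := X) d f1 /\ fn (p := X) d f2 &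
      forall z, V z -> W z -> [/\ f2 z != 0, h z = f1 z / f2 z &
        g z = tval z (bdual c s j) * h z]].
  move=> Vy; have [W [d [f1 [f2 [[oW Wy] [ds Wd] ff _ H]]]]] := hP y Vy.
  exists W, d, f1, f2; split=> // z Vz Wz; have [nz gz] := H z Vz Wz.
  suff E : h z = f1 z / f2 z by rewrite E.
  apply: divided_unique oV Vz (hP z Vz) _.
  by exists W, d, f1, f2.
exists h => y Vy; last first.
  have [W [d [f1 [f2 [oW Wy Wd ff H]]]]] := key y Vy.
  by have [] := H y Vy Wy.
have [W [d [f1 [f2 [oW Wy Wd ff H]]]]] := key y Vy.
by exists W, d, f1, f2; split=> // z Vz Wz; have [] := H z Vz Wz.
Qed.

(** The character cutting out the [l]-th divisor in the chart [bcone s]: it is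
    trivial if the chart does not meet the divisor. *)
Definition bdiv s l : 'rV[int]_k :=
  if l \in bcone s then bdual c s (bidx l) else 0.

Lemma local_equation_bdiv s l :
  local_equation (tdivisor (Sigma := Sigma) l)
    (dom (p := X) (bchart c s)) (fun x => tval x (bdiv s l)).
Proof.
rewrite /bdiv; case: ifPn => ls.
  have El : l = bgen s (bidx l) by apply/eqP; rewrite -mem_bcone.
  by have := local_equation_bdual s (bidx l); rewrite -El.
split.
  apply: (regular_ext (F := fun=> 1)); last exact: regular_cst.
  by move=> x; rewrite tval0.
move=> V g oV Vs rg; split=> [_|_ y Vy /tdivisorP ly].
  by exists g => // y _; rewrite tval0 mul1r.
by case/negP: ls; apply: fintype.subsetP ly; apply: Vs.
Qed.

End Divisors.

(** * The bundle *)

Section Matrices2.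
Variable K : comNzRingType.

Definition mx2 (a b c d : K) : 'M[K]_2 :=
  \matrix_(i, j) if i == 0 then if j == 0 then a else b
                 else if j == 0 then c else d.

Lemma mx2E a b c d : (mx2 a b c d 0 0 = a) * (mx2 a b c d 0 1 = b) *
  (mx2 a b c d 1 0 = c) * (mx2 a b c d 1 1 = d).
Proof. by rewrite !mxE. Qed.

Lemma mx2_eq (A B : 'M[K]_2) : A 0 0 = B 0 0 -> A 0 1 = B 0 1 ->
  A 1 0 = B 1 0 -> A 1 1 = B 1 1 -> A = B.
Proof.
have I2 (i : 'I_2) : i = 0 \/ i = 1.
  by case: i => [[|[|//]] Hi]; [left|right]; apply: val_inj.
by move=> H00 H01 H10 H11; apply/matrixP => i j; have [->|->] := I2 i; have [->|->] := I2 j.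
Qed.

Lemma mulmx2 (A B : 'M[K]_2) i j : (A *m B) i j = A i 0 * B 0 j + A i 1 * B 1 j.
Proof.
have lift1 : lift ord0 ord0 = 1 :> 'I_2 by apply: val_inj.
by rewrite mxE !big_ord_recl big_ord0 addr0 lift1.
Qed.

Lemma mx2_ex (A : 'M[K]_2) : A = mx2 (A 0 0) (A 0 1) (A 1 0) (A 1 1).
Proof. by apply: mx2_eq; rewrite !mx2E. Qed.

Lemma mx2M a b c d a' b' c' d' : mx2 a b c d *m mx2 a' b' c' d' =
  mx2 (a * a' + b * c') (a * b' + b * d') (c * a' + d * c') (c * b' + d * d').
Proof. by apply: mx2_eq; rewrite mulmx2 !mx2E. Qed.

Lemma mx2_1 : 1%:M = mx2 1 0 0 1.
Proof. by apply: mx2_eq; rewrite !mxE. Qed.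

Lemma det_mx2_trig a c d : \det (mx2 a 0 c d) = a * d.
Proof.
rewrite det_trig; last first.
  by apply/is_trig_mxP => -[[|[|//]] Hi] [[|[|//]] Hj] // _; rewrite mxE.
by rewrite !big_ord_recl big_ord0 mulr1 !mxE.
Qed.

End Matrices2.

Section Bundle.
Variables (K : fieldType) (k : nat) (c : 'I_k -> 'I_k -> nat).
Variables (p : 'I_k) (q : 'I_(k + k)).
Let Sigma := bott_fan c.
Let X := toric_variety K Sigma.
Implicit Types (s t w : 'I_k -> bool) (x : X) (tau : {set 'I_(k + k)}).

(** In the chart of [s] the characters [char_a s] and [char_b s] are equations
    of [D_p + D_(k+p)] and of [D_q]; the basis of the bundle is
    [(e_p - (s p) e_q) / char_a s] and [e_q / char_b s], and [ptrans s t]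
    expresses it in the basis of the chart of [t]. *)
Definition char_a s := bdual c s p.
Definition char_b s := bdiv c s q.
Definition side s t : K := (t p)%:R - (s p)%:R.

Definition ptrans s t x : 'M[K]_2 :=
  mx2 (tval x (char_a t - char_a s)) 0
      (side s t * tval x (char_b t - char_a s)) (tval x (char_b t - char_b s)).

Lemma pairing_a s l : l \in bcone s ->
  pairing (char_a s) (ray Sigma l) = (p == bidx l)%:Z.
Proof. by rewrite mem_bcone => /eqP {1}->; rewrite pairing_bdual. Qed.

Lemma pairing_b s l : l \in bcone s ->
  pairing (char_b s) (ray Sigma l) = (q == l)%:Z.
Proof.
move=> ls; have El : l = bgen s (bidx l) by apply/eqP; rewrite -mem_bcone.
rewrite /char_b /bdiv; case: ifPn => qs; last first.
  by rewrite pairing0l; case: eqP => // ql; rewrite ql ls in qs.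
rewrite [in LHS]El pairing_bdual; congr (Posz (nat_of_bool _)).
rewrite mem_bcone in qs; apply/eqP/eqP => [E|->//].
by rewrite (eqP qs) E -El.
Qed.

(** The three characters occurring in a transition matrix are regular on the
    intersection of the charts.  For the off-diagonal one this needs the two
    charts to lie on different sides, so that [char_a s] is invertible on their
    intersection; otherwise its coefficient is zero. *)
Section Pair.
Variables (s t : 'I_k -> bool) (tau : {set 'I_(k + k)}).
Hypotheses (ss : tau \subset bcone s) (tt : tau \subset bcone t).

Lemma perp_aa : perp_cone Sigma tau (char_a t - char_a s).
Proof.
apply/perp_coneP => l lt; rewrite pairingBl !pairing_a ?subrr //.
  exact: (fintype.subsetP ss).
exact: (fintype.subsetP tt).
Qed.

Lemma perp_bb : perp_cone Sigma tau (char_b t - char_b s).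
Proof.
apply/perp_coneP => l lt; rewrite pairingBl !pairing_b ?subrr //.
  exact: (fintype.subsetP ss).
exact: (fintype.subsetP tt).
Qed.

Lemma dual_ba : s p != t p -> dual_cone Sigma tau (char_b t - char_a s).
Proof.
move=> st; apply/dual_coneP => l lt; rewrite pairingBl.
have ls := fintype.subsetP ss _ lt; have lt' := fintype.subsetP tt _ lt.
rewrite pairing_b // pairing_a //; case: (p =P bidx l) => [E|_]; last by rewrite subr0.
move: ls lt' st; rewrite !mem_bcone -E => /eqP-> /eqP.
rewrite /bgen; case: (s p); case: (t p) => // /eqP.
  by rewrite eq_rlshift.
by rewrite eq_lrshift.
Qed.

End Pair.

Lemma side0 s t : s p = t p -> side s t = 0.
Proof. by rewrite /side => ->; rewrite subrr. Qed.

Lemma tval_mid x m1 m2 m3 : dual_cone Sigma (tcone x) (m1 - m2) ->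
  dual_cone Sigma (tcone x) (m2 - m3) ->
  tval x (m1 - m2) * tval x (m2 - m3) = tval x (m1 - m3).
Proof. by move=> d1 d2; rewrite -tvalD // addrA subrK. Qed.

Lemma ptrans_cocycle s t w x : tcone x \subset bcone s -> tcone x \subset bcone t ->
  tcone x \subset bcone w -> ptrans t w x *m ptrans s t x = ptrans s w x.
Proof.
move=> xs xt xw; rewrite mx2M !(mulr0, mul0r, addr0, add0r).
rewrite !tval_mid ?perp_dual ?perp_aa ?perp_bb //; congr mx2.
have -> : side t w * tval x (char_b w - char_a t) * tval x (char_a t - char_a s) =
    side t w * tval x (char_b w - char_a s).
  have [E|ne] := eqVneq (t p) (w p); first by rewrite side0 // !mul0r.
  by rewrite -mulrA tval_mid // ?dual_ba // perp_dual // perp_aa.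
have -> : tval x (char_b w - char_b t) * (side s t * tval x (char_b t - char_a s)) =
    side s t * tval x (char_b w - char_a s).
  have [E|ne] := eqVneq (s p) (t p); first by rewrite side0 // !mul0r mulr0.
  by rewrite mulrCA tval_mid // ?dual_ba // perp_dual // perp_bb.
by rewrite -mulrDl /side addrA subrK.
Qed.

Lemma ptrans_id s x : ptrans s s x = 1%:M.
Proof. by rewrite /ptrans !subrr side0 // mul0r !tval0 -mx2_1. Qed.

Lemma ptransK s t x : tcone x \subset bcone s -> tcone x \subset bcone t ->
  ptrans t s x *m ptrans s t x = 1%:M.
Proof. by move=> xs xt; rewrite ptrans_cocycle // ptrans_id. Qed.

Lemma meet_cone s t : is_cone Sigma (bcone s :&: bcone t).
Proof. exact: sub_bcone_is_cone (finset.subsetIl _ _). Qed.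

Definition bmeet s t : tchart Sigma := Sub (bcone s :&: bcone t) (meet_cone s t).

Lemma bmeetE s t x : dom (p := X) (bmeet s t) x <->
  (tcone x \subset bcone s) /\ (tcone x \subset bcone t).
Proof. by rewrite /dom /= /tdomain /= finset.subsetI; split=> [/andP|[-> ->]]. Qed.

(** Single characters make the regularity of the entries evident, both on the
    variety and, for the action, on its product with the torus. *)
Lemma ptrans_entry s t i j : exists a m,
  dual_cone Sigma (bcone s :&: bcone t) m /\
  forall x, ptrans s t x i j = a * tval x m.
Proof.
have ss := finset.subsetIl (bcone s) (bcone t).
have tt := finset.subsetIr (bcone s) (bcone t).
have d0 : dual_cone Sigma (bcone s :&: bcone t) 0.
  by apply/dual_coneP => l _; rewrite pairing0l.
rewrite /ptrans; case: i => [[|[|//]] Hi]; case: j => [[|[|//]] Hj].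
- exists 1, (char_a t - char_a s); split; first by rewrite perp_dual // perp_aa.
  by move=> x; rewrite mxE mul1r.
- by exists 0, 0; split=> // x; rewrite mxE mul0r.
- have [E|ne] := eqVneq (s p) (t p).
    by exists 0, 0; split=> // x; rewrite mxE /= side0 // !mul0r.
  by exists (side s t), (char_b t - char_a s); split=> [|x]; [apply: dual_ba|rewrite mxE].
- exists 1, (char_b t - char_b s); split; first by rewrite perp_dual // perp_bb.
  by move=> x; rewrite mxE mul1r.
Qed.

(** All fibres are the plane of coordinates in one fixed chart containing the
    point, chosen as a function of its cone only, so that the torus preserves
    the choice. *)
Definition ptriv s (x : X) (v : 'cV[K]_2) : 'cV[K]_2 := ptrans (bhome (tcone x)) s x *m v.

Lemma ptdom_cover x : exists s, dom (p := X) (bchart c s) x.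
Proof. by exists (bhome (tcone x)); apply: bhome_sub (tcone_fan x). Qed.

Lemma ptriv_linear s x : dom (p := X) (bchart c s) x -> linear (ptriv s x).
Proof. by move=> _ a u v; rewrite /ptriv linearP. Qed.

Lemma ptriv_bij s x : dom (p := X) (bchart c s) x -> bijective (ptriv s x).
Proof.
move=> xs; have xh := bhome_sub (tcone_fan x).
exists (fun v => ptrans s (bhome (tcone x)) x *m v) => v;
  by rewrite /ptriv mulmxA ptransK // mul1mx.
Qed.

Lemma ptrans_regular s t :
  regular_mx (dom (p := X) (bchart c s) `&` dom (p := X) (bchart c t)) (ptrans s t).
Proof.
move=> i j; have [a [m [dm E]]] := ptrans_entry s t i j.
apply: regular_ext (fun x => esym (E x)) _.
apply: (@regular_fn _ X (bmeet s t)).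
  by apply: (@tfn_scale _ _ _ _ (bmeet s t)); apply: tfn_tval.
by move=> x [xs xt]; apply/bmeetE.
Qed.

Lemma ptransE s t x : dom (p := X) (bchart c s) x -> dom (p := X) (bchart c t) x ->
  forall v, ptriv t x v = ptrans s t x *m ptriv s x v.
Proof.
move=> xs xt v; rewrite /ptriv mulmxA ptrans_cocycle //.
exact: bhome_sub (tcone_fan x).
Qed.

Definition pbundle : vbundle X :=
  @Vbundle K X 2 (fun=> 'cV[K]_2) ('I_k -> bool) (fun s => dom (p := X) (bchart c s))
    ptriv ptrans (fun s => @zopen_dom K X (bchart c s)) ptdom_cover
    ptriv_linear ptriv_bij ptrans_regular ptransE.

(** * The torus action *)

Definition pweight s (t : torus K k) : 'M[K]_2 :=
  mx2 (chi t (char_a s)) 0 0 (chi t (char_b s)).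

Lemma pweight_trans s t (z : torus K k) x :
  ptrans s t (tact z x) *m pweight s z = pweight t z *m ptrans s t x.
Proof.
have chiB m1 m2 : chi z (m1 - m2) * chi z m2 = chi z m1 by rewrite -chiD subrK.
rewrite !mx2M !(mulr0, mul0r, addr0, add0r) /=; congr mx2.
- by rewrite mulrAC chiB.
- by rewrite -mulrA mulrAC chiB mulrCA.
- by rewrite mulrAC chiB.
Qed.

Definition pact (z : torus K k) (x : X) (v : fib pbundle x) : fib pbundle (tact z x) :=
  pweight (bhome (tcone x)) z *m v.

Lemma total_eq (x y : X) (v w : 'cV[K]_2) : x = y -> v = w ->
  existT (fib pbundle) x v = existT (fib pbundle) y w.
Proof. by move=> -> ->. Qed.

Lemma pact_regular s t :
  regular_mx (X := prod_prevariety (torus K k) X)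
    [set z | dom (p := X) (bchart c s) z.2 /\ dom (p := X) (bchart c t) (tact z.1 z.2)]
    (fun z => pweight t z.1 *m ptrans s t z.2).
Proof.
move=> i j; have [e1 [m1 E1]] : exists (e : K) m, forall z, pweight t z i i = e * chi z m.
  case: i => [[|[|//]] Hi]; [exists 1, (char_a t)|exists 1, (char_b t)] => z;
  by rewrite mxE mul1r.
have [e2 [m2 [d2 E2]]] := ptrans_entry s t i j.
apply: (@regular_ext K (prod_prevariety (torus K k) X) _
  (fun z => (e1 * chi z.1 m1) * (e2 * tval z.2 m2))).
  move=> z; rewrite -E1 -E2 [RHS]mxE (bigD1 i) //= big1 ?addr0 // => l la.
  rewrite [pweight _ _ _ _]mxE; move: la.
  by case: i {E1 E2} => [[|[|//]] Hi]; case: l => [[|[|//]] Hl] //=; rewrite mul0r.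
apply: (@regular_fn _ _ ((tt, bmeet s t) : chart (prod_prevariety (torus K k) X))).
  exists 1%N, (fun=> fun z => e1 * chi z m1), (fun=> fun x => e2 * tval x m2).
  split=> [_|z]; last by rewrite big_ord1.
  split; last by apply: (@tfn_scale _ _ _ _ (bmeet s t)); apply: tfn_tval.
  by exists 1%N, (fun=> e1), (fun=> m1) => z; rewrite big_ord1.
by move=> [z x] [xs xt]; split=> //; apply/bmeetE.
Qed.

Lemma pbundle_equivariant : equivariant pbundle.
Proof.
exists pact; split.
- by move=> z x a u v; rewrite /pact linearP.
- case=> x v; apply: total_eq; first exact: tact1.
  rewrite /pact /pweight /= (_ : mx2 _ _ _ _ = 1%:M) ?mul1mx //.
  by rewrite mx2_1.
- move=> z w [x v]; apply: total_eq; first exact: tactM.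
  by rewrite /pact /= mulmxA mx2M !(mulr0, mul0r, addr0, add0r).
move=> i j U.
exists (fun zx => pweight j zx.1 *m ptrans i j zx.2); first exact: pact_regular.
move=> z x [xi xj] v; rewrite /= /ptriv /pact mulmxA /=.
rewrite pweight_trans -!mulmxA; congr (_ *m _); rewrite mulmxA ptrans_cocycle //.
exact: bhome_sub (tcone_fan x).
Qed.

End Bundle.

(** * The first Chern class *)

Section Chern.
Variables (K : closedFieldType) (k : nat) (c : 'I_k -> 'I_k -> nat).
Variables (p : 'I_k) (q : 'I_(k + k)).
Let Sigma := bott_fan c.
Let X := toric_variety K Sigma.

Lemma bdiv_dual s l (tau : {set 'I_(k + k)}) :
  tau \subset bcone s -> dual_cone Sigma tau (bdiv c s l).
Proof.
by move=> ts; apply/dual_coneP => l' /(fintype.subsetP ts) /(pairing_b _)->.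
Qed.

Lemma char_a_bdiv s : char_a c p s = bdiv c s (lshift k p) + bdiv c s (rshift k p).
Proof.
rewrite /bdiv lshift_cone rshift_cone bidx_lshift bidx_rshift /char_a.
by case: (s p); rewrite ?addr0 ?add0r.
Qed.

(** The section is the exterior product of the constant vectors [e_p] and [e_q]:
    the basis of the chart of [s] has determinant [1 / (char_a s * char_b s)], so
    its coordinate is the value of [char_a s + char_b s]. *)
Lemma pbundle_c1 : q != lshift k p -> q != rshift k p ->
  c1_eq (pbundle K c p q) (tdivisor (Sigma := Sigma))
    (fun l => (l == lshift k p)%:Z + (l == q)%:Z + (l == rshift k p)%:Z).
Proof.
move=> qp qp'.
exists (fun s x => tval x (char_a c p s + char_b c q s)); split.
  move=> s t x _ xs xt.
  rewrite /= /ptrans det_mx2_trig.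
  have daa : perp_cone Sigma (tcone x) (char_a c p t - char_a c p s) by apply: perp_aa.
  have dbb : perp_cone Sigma (tcone x) (char_b c q t - char_b c q s) by apply: perp_bb.
  have da : dual_cone Sigma (tcone x) (char_a c p s).
    by rewrite char_a_bdiv dual_coneD // bdiv_dual.
  have db : dual_cone Sigma (tcone x) (char_b c q s) by apply: bdiv_dual.
  rewrite -tvalD ?perp_dual // -tvalD; last 2 first.
  - by rewrite dual_coneD // perp_dual.
  - by rewrite dual_coneD.
  by congr (tval x _); rewrite addrACA !subrK.
move=> s x xs; exists (dom (p := X) (bchart c s)), (fun=> 1), (fun l x => tval x (bdiv c s l)).
split=> //.
- exact: zopen_dom.
- by split.
- by split=> [|y _]; [apply: regular_cst|apply: oner_neq0].
- by move=> l; apply: local_equation_bdiv.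
move=> y ys _; rewrite mul1r.
rewrite (bigD1 (lshift k p)) //= (bigD1 q) //= (bigD1 (rshift k p)) /=; last first.
  by rewrite eq_rlshift eq_sym qp'.
rewrite big1 => [|l /andP[/andP[/negPf-> /negPf->] /negPf->]]; last by rewrite expr0z.
rewrite !eqxx (negPf qp) (negPf qp') [_ == q]eq_sym [rshift k p == q]eq_sym.
rewrite (negPf qp) (negPf qp') eq_lrshift eq_rlshift !(addr0, add0r) !expr1z mulr1.
rewrite char_a_bdiv addrAC !tvalD ?dual_coneD ?bdiv_dual //.
by rewrite mulrA.
Qed.

End Chern.

(** * Indecomposability *)

Section Decomposition.
Variables (K : fieldType) (X : prevariety K) (E : vbundle X).

Lemma linear_fun0 (U V : lmodType K) (f : U -> V) : linear f -> f 0 = 0.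
Proof. by move=> /(_ (-1) 0 0); rewrite scaler0 addr0 scaleN1r addNr. Qed.

Lemma mulmx_inj m n (A B : 'M[K]_(m, n)) :
  (forall v : 'cV_n, A *m v = B *m v) -> A = B.
Proof.
move=> H; apply/matrixP => i j.
by have := congr1 (fun w : 'cV_m => w i 0) (H (delta_mx j 0)); rewrite -!colE !mxE.
Qed.

Lemma fib_neq0 (F : vbundle X) x : (0 < rk F)%N -> exists v : fib F x, v <> 0.
Proof.
move=> rF; have [j jx] := tdom_cover F x; have [g g1 g2] := triv_bij jx.
exists (g (const_mx 1)) => /(congr1 (triv j x)); rewrite g2.
rewrite (linear_fun0 (triv_linear jx)) => /matrixP/(_ (Ordinal rF) 0).
by rewrite !mxE => /eqP; rewrite oner_eq0.
Qed.

(** [N] is the matrix of the projection onto the first summand.  The projection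
    has nonzero kernel and nonzero image in every fibre, so it is not a scalar. *)
Lemma decomposable_idempotent : ~ indecomposable E ->
  exists N : tidx E -> X -> 'M[K]_(rk E),
  [/\ forall i x, tdom i x -> N i x *m N i x = N i x,
      forall i x a, tdom i x -> N i x <> a%:M,
      forall i j x, tdom i x -> tdom j x ->
        N j x *m trans i j x = trans i j x *m N i x
    & forall i x, tdom i x -> exists r W (A : X -> 'M[K]_(r, rk E)) (D : 'M[K]_r)
          (B : X -> 'M[K]_(rk E, r)),
        [/\ zopen W /\ W x, regular_mx W A, regular_mx W B
          & forall y, W y -> N i y = B y *m D *m A y]].
Proof.
move=> /contrapT [F [G [rF rG [phi [psi [[phil phiA] [psil psiA] phiK psiK]]]]]].
pose th x v : fib E x := psi x ((phi x v).1, 0).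
have loc i x : tdom i x -> exists r W (A : X -> 'M[K]_(r, rk E)) (D : 'M[K]_r)
          (B : X -> 'M[K]_(rk E, r)),
        [/\ zopen W /\ W x, W `<=` tdom i, regular_mx W A, regular_mx W B
          & forall y, W y -> forall v, triv i y (th y v) = B y *m D *m A y *m triv i y v].
  move=> ix; have [j jx] := tdom_cover (dsum F G) x.
  have [A rA EA] := phiA i j; have [B rB EB] := psiA j i.
  exists (rk (dsum F G)), (tdom i `&` tdom j), A, (block_mx 1%:M 0 0 0), B; split=> //.
  - by split; [apply: zopenI; apply: tdom_open|].
  - by move=> a b; apply: regularS (rB a b) => y [].
  move=> y [iy jy] v; rewrite EB // -mulmxA -mulmxA -EA //; congr (_ *m _).
  rewrite /= /dsum_triv /= mul_block_col !mul0mx !addr0 mul1mx.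
  by rewrite (linear_fun0 (triv_linear jy.2)).
have exN i x : exists M : 'M[K]_(rk E),
    tdom i x -> forall v, triv i x (th x v) = M *m triv i x v.
  have [ix|nix] := pselect (tdom i x); last by exists 0.
  have [r [W [A [D [B [[oW Wx] Wi rA rB H]]]]]] := loc i x ix.
  by exists (B x *m D *m A x) => _; apply: H.
pose N i x := sval (cid (exN i x)).
have NP i x : tdom i x -> forall v, triv i x (th x v) = N i x *m triv i x v.
  by rewrite /N; case: cid.
have uniqN i x M M' : tdom i x ->
    (forall v, M *m triv i x v = M' *m triv i x v) -> M = M' :> 'M[K]_(rk E).
  move=> ix H; apply: mulmx_inj => v; have [g g1 g2] := triv_bij ix.
  by rewrite -(g2 v).
exists N; split.
- move=> i x ix; apply: (uniqN i x) => // v; rewrite -mulmxA -!NP //.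
  by rewrite /th psiK.
- move=> i x a ix Na.
  have [v v0] := fib_neq0 x rF; have [w w0] := fib_neq0 x rG.
  have psi0 : psi x 0 = 0 := linear_fun0 (psil x).
  have [g g1 g2] := triv_bij ix.
  have triv0 : triv i x 0 = 0 := linear_fun0 (triv_linear ix).
  have a0 : a = 0.
    apply/eqP/negPn/negP => a0; apply: w0.
    have := NP i x ix (psi x (0, w)); rewrite Na /th psiK /= psi0 triv0 mul_scalar_mx.
    move/esym/eqP; rewrite scaler_eq0 (negPf a0) /= => /eqP H.
    have : psi x (0, w) = 0 by rewrite -(g1 (psi x (0, w))) H -triv0 g1.
    by move/(congr1 (phi x)); rewrite psiK (linear_fun0 (phil x)) => -[].
  apply: v0; have := NP i x ix (psi x (v, 0)).
  rewrite Na a0 mul_scalar_mx scale0r /th psiK /= => H.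
  have : psi x (v, 0) = 0 by rewrite -(g1 (psi x (v, 0))) H -triv0 g1.
  by move/(congr1 (phi x)); rewrite psiK (linear_fun0 (phil x)) => -[].
- move=> i j x ix jx; apply: (uniqN i x) => // v.
  by rewrite -!mulmxA -NP // -!transE // NP.
- move=> i x ix; have [r [W [A [D [B [oW Wi rA rB H]]]]]] := loc i x ix.
  exists r, W, A, D, B; split=> // y Wy; apply: (uniqN i y); first exact: Wi.
  by move=> v; rewrite -NP ?H //; apply: Wi.
Qed.

End Decomposition.

(** With [a = d] and [b * e = 0], idempotency says that [a] is [0] or [1] and
    that [b] and [e] are killed by [2 * a - 1], which is then [1] or [-1]. *)
Lemma idempotent_scalar (K : fieldType) (A : 'M[K]_2) : A *m A = A ->
  A 0 0 = A 1 1 -> A 0 1 * A 1 0 = 0 -> exists a, A = a%:M.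
Proof.
move=> AA ad bc.
have E i j := esym (mulmx2 A A i j); rewrite AA in E.
have aa : A 0 0 * A 0 0 = A 0 0 by have := E 0 0; rewrite bc addr0.
have unit_key b : A 0 0 * b + b * A 0 0 = b -> b = 0.
  move=> H; have : A 0 0 * (A 0 0 - 1) = 0 by rewrite mulrBr aa mulr1 subrr.
  move/eqP; rewrite mulf_eq0 subr_eq0 => /orP[/eqP z|/eqP z]; move: H; rewrite z.
    by rewrite mul0r mulr0 addr0.
  by rewrite mul1r mulr1 => /(canRL (addrK b)); rewrite subrr.
have b0 : A 0 1 = 0 by apply: unit_key; rewrite {2}ad; exact: E.
have c0 : A 1 0 = 0 by apply: unit_key; rewrite addrC {2}ad; exact: E.
by exists (A 0 0); rewrite (mx2_ex A) b0 c0 -ad !mx2E; apply: mx2_eq; rewrite !mxE.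
Qed.

Section OnTheLine.
Variable K : closedFieldType.

(** [F] and [F'] are the matrices, at [x] and at [1 / x], of an endomorphism of
    the bundle on the projective line glued by [mx2 (x ^- 2) 0 (eta / x) 1].
    This bundle is [O(1) + O(1)] if [eta != 0] and [O(2) + O] otherwise.  The
    entries of [F] are polynomials [a], [b], [e], [d]; regularity at infinity of
    the two entries above and below the diagonal gives [deg b <= 2] and
    [deg Q <= 0], where [Q = x^2 e + eta x (a - d) - eta^2 b].  The coefficients
    of degree [2] and [1] of [Q] yield the two conclusions; the right-hand side
    of the second is a multiple of the linear coefficient of [b], extracted from
    three values of [b] so as to depend regularly on parameters. *)
Lemma endomorphism_on_line (eta : K) (F F' : K -> 'M[K]_2) :
  (forall z, rational_mx z F) -> rational_mx 0 F' ->
  (forall x, x != 0 ->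
     F' x^-1 *m mx2 (x ^- 2) 0 (eta / x) 1 = mx2 (x ^- 2) 0 (eta / x) 1 *m F x) ->
  (eta = 0 -> F 0 1 0 = 0) /\
  (eta != 0 -> forall w, (w - w ^+ 2) * (F 0 0 0 - F 0 1 1) =
     eta * (F w 0 1 - F 0 0 1 - w ^+ 2 * (F 1 0 1 - F 0 0 1))).
Proof.
move=> rF rF' H.
have [a Ea] := entire_poly (fun z => rF z 0 0).
have [b Eb] := entire_poly (fun z => rF z 0 1).
have [d Ed] := entire_poly (fun z => rF z 1 1).
have [e Ee] := entire_poly (fun z => rF z 1 0).
have rel x : x != 0 -> b.[x] = x ^+ 2 * F' x^-1 0 1 /\
    x ^+ 2 * e.[x] + eta * x * (a.[x] - d.[x]) - eta ^+ 2 * b.[x] = F' x^-1 1 0.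
  move=> x0; have M i j := congr1 (fun B : 'M[K]_2 => B i j) (H x x0).
  have := M 0 1; have := M 1 1; have := M 1 0.
  rewrite /= !mulmx2 !mx2E !(mulr0, mul0r, mulr1, mul1r, addr0, add0r) -Ea -Eb -Ed -Ee.
  set f := F' _ => M10 M11 M01; split.
    by rewrite M01 mulVKf // expf_neq0.
  have : f 1 0 = x ^+ 2 * (f 1 0 * x ^- 2) by rewrite mulrCA divff ?expf_neq0 ?mulr1.
  rewrite (_ : f 1 0 * x ^- 2 =
    eta / x * F x 0 0 + F x 1 0 - f 1 1 * (eta / x)); last first.
    by rewrite -M10 addrK.
  by rewrite M11 => ->; field.
have sb : (size b <= 3)%N.
  by apply: (@size_pole_at_infinity _ b 2 _ (rF' 0 1)) => x x0; have [] := rel x x0.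
pose Q := 'X^2 * e + eta *: ('X * (a - d)) - eta ^+ 2 *: b.
have sQ : (size Q <= 1)%N.
  apply: (@size_pole_at_infinity _ Q 0 _ (rF' 1 0)) => x x0.
  rewrite mul1r; have [_ <-] := rel x x0.
  by rewrite /Q !hornerE /=; ring.
have Qi i : (0 < i)%N -> Q`_i = 0 by move=> i0; rewrite nth_default // (leq_trans sQ).
have Q1 : eta * (a`_0 - d`_0) - eta ^+ 2 * b`_1 = 0.
  by have := Qi 1%N isT; rewrite /Q !coefE /= add0r.
have Q2 : e`_0 + eta * (a`_1 - d`_1) - eta ^+ 2 * b`_2 = 0.
  by have := Qi 2%N isT; rewrite /Q !coefE.
split=> [eta0|eta0 w].
  by rewrite Ee horner_coef0; move: Q2; rewrite eta0 expr2 !mul0r subr0 addr0.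
have bE x : b.[x] = b`_0 + b`_1 * x + b`_2 * x ^+ 2.
  by rewrite (horner_coef_wide _ sb) !big_ord_recl big_ord0 /= expr0 expr1 mulr1 addr0 addrA.
have ad : a`_0 - d`_0 = eta * b`_1.
  by apply: (mulfI eta0); apply/eqP; rewrite -subr_eq0 mulrA -expr2 Q1.
rewrite Ea Ed !Eb !horner_coef0 ad !bE; ring.
Qed.

End OnTheLine.

(** ** The two families of lines *)

(** [N] is an endomorphism of the bundle, given by its matrices in the charts,
    whose restrictions to polynomial curves are locally rational. *)
Section Indecomposable.
Variables (K : closedFieldType) (k : nat) (c : 'I_k -> 'I_k -> nat).
Variables (p : 'I_k) (q : 'I_(k + k)).
Let Sigma := bott_fan c.
Let X := toric_variety K Sigma.
Let E := pbundle K c p q.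
Let r := bidx q.
Hypothesis rp : r != p.
Implicit Types (s : 'I_k -> bool) (x y z : K).

Variable N : ('I_k -> bool) -> X -> 'M[K]_2.
Hypothesis N_trans : forall s t (P : X), tcone P \subset bcone s -> tcone P \subset bcone t ->
  N t P *m ptrans p q s t P = ptrans p q s t P *m N s P.
Hypothesis N_rational : forall s T z, rational_mx z (fun w => N s (bcurve c s T w)).

Definition surf s x y : X := bpt c s (fun i => if i == p then x else if i == r then y else 0).

Lemma surf_sub s x y : tcone (surf s x y) \subset bcone s.
Proof. exact: bptcone_sub. Qed.

Lemma surf_rational s (P Q : {poly K}) z :
  rational_mx z (fun w => N s (surf s P.[w] Q.[w])).
Proof.
move=> i j; apply: rational_at_ext
  (N_rational s (fun i => if i == p then P else if i == r then Q else 0) z i j) => w.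
congr (N s _ i j); apply: bpt_ext => l.
by do 2?case: ifP => // _; rewrite horner0.
Qed.

Lemma surf_rational1 s y z : rational_mx z (fun w => N s (surf s w y)).
Proof.
move=> i j; apply: rational_at_ext (surf_rational s 'X y%:P z i j) => w.
by rewrite hornerX hornerC.
Qed.

Lemma surf_rational2 s x z : rational_mx z (fun w => N s (surf s x w)).
Proof.
move=> i j; apply: rational_at_ext (surf_rational s x%:P 'X z i j) => w.
by rewrite hornerX hornerC.
Qed.

Lemma surf_flip1 s x y : x != 0 -> (r < p)%N \/ y = 0 ->
  surf (bflip s p) x^-1 y = surf s x y.
Proof.
move=> x0 ry; rewrite /surf -(@bpt_flip _ _ c s _ p); first last.
- move=> j pj; rewrite -val_eqE gtn_eqF //.
  case: eqP => // jr; case: ry => // rp'.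
  by move: pj; rewrite jr ltnNge ltnW.
- by rewrite eqxx.
by apply: bpt_ext => i; rewrite /binv eqxx; case: eqP.
Qed.

Lemma surf_flip2 s x y : y != 0 -> (p < r)%N ->
  surf (bflip s r) x y^-1 = surf s x y.
Proof.
move=> y0 pr; rewrite /surf -(@bpt_flip _ _ c s _ r); first last.
- move=> j rj; rewrite -!val_eqE (gtn_eqF rj) gtn_eqF //; exact: ltn_trans rj.
- by rewrite (negPf rp) eqxx.
by apply: bpt_ext => i; rewrite /binv eqxx (negPf rp);
  have [->|//] := eqVneq i r; rewrite (negPf rp).
Qed.

Lemma surf_tval s x y m :
  (forall i, i != p -> i != r -> pairing m (ray Sigma (bgen s i)) = 0) ->
  tval (surf s x y) m = x ^ pairing m (ray Sigma (bgen s p)) *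
                        y ^ pairing m (ray Sigma (bgen s r)).
Proof.
move=> H; rewrite /= /bptval (bigD1 p) //= eqxx (bigD1 r) //= eqxx (negPf rp).
rewrite big1 ?mulr1 // => i /andP[ip ir].
by rewrite (negPf ip) (negPf ir) H // expr0z.
Qed.

Lemma pairing_flip s i j m : j != i ->
  pairing m (ray Sigma (bgen (bflip s i) j)) = pairing m (ray Sigma (bgen s j)).
Proof. by move=> ji; rewrite bgen_flip. Qed.

(** Flipping [p] keeps the characters of [q], since their coordinates from [p]
    onwards vanish, and changes the character of [p] to its opposite. *)
Lemma ptrans_flip1 s x y : x != 0 -> s p = false ->
  (r < p)%N \/ q \notin bcone s ->
  ptrans p q s (bflip s p) (surf s x y) =
    mx2 (x ^- 2) 0 ((if q \in bcone s then y else 1) / x) 1.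
Proof.
move=> x0 sp rq; set t := bflip s p.
have tp : t p = true by rewrite /t /bflip eqxx sp.
have at_p : pairing (char_a c p t) (ray Sigma (bgen s p)) = -1.
  have top (j : 'I_k) : (p < j)%N -> pairing (char_a c p t) (ray Sigma (bgen t j)) = 0.
    by move=> pj; rewrite pairing_bdual -val_eqE ltn_eqF.
  have := pairing_top t top; rewrite pairing_bdual eqxx tp.
  rewrite (pairing_top s top) sp mul1r => /eqP.
  by rewrite mulN1r -eqr_oppLR => /eqP.
have qs_t : (q \in bcone s) = (q \in bcone t).
  by rewrite !mem_bcone bgen_flip.
have bt_p : pairing (char_b c q t) (ray Sigma (bgen s p)) = 0.
  have top (j : 'I_k) : (p <= j)%N -> pairing (char_b c q t) (ray Sigma (bgen t j)) = 0.
    move=> pj; rewrite pairing_b ?bgen_cone //; case: eqP => // qj.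
    case: rq => [rp'|]; last by rewrite qs_t qj bgen_cone.
    by move: rp'; rewrite /r qj bgenK ltnNge pj.
  have top' (j : 'I_k) : (p < j)%N -> pairing (char_b c q t) (ray Sigma (bgen t j)) = 0.
    by move=> pj; apply: top; apply: ltnW.
  have := pairing_top t top'; rewrite top // tp mulN1r.
  rewrite (pairing_top s top') sp mul1r => /esym/eqP.
  by rewrite oppr_eq0 => /eqP.
have as_ i : pairing (char_a c p s) (ray Sigma (bgen s i)) = (p == i)%:Z.
  by rewrite pairing_bdual.
have at_ i : i != p -> pairing (char_a c p t) (ray Sigma (bgen s i)) = 0.
  by move=> ip; rewrite -(pairing_flip _ _ ip) pairing_bdual eq_sym (negPf ip).
have bs_ i : pairing (char_b c q s) (ray Sigma (bgen s i)) = (q == bgen s i)%:Z.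
  by rewrite pairing_b ?bgen_cone.
have bt_ i : i != p -> pairing (char_b c q t) (ray Sigma (bgen s i)) = (q == bgen s i)%:Z.
  by move=> ip; rewrite -(pairing_flip _ _ ip) pairing_b ?bgen_cone // bgen_flip.
have qi i : i != r -> (q == bgen s i) = false.
  by move=> ir; apply: contraNF ir => /eqP E'; rewrite /r E' bgenK.
have sd : side K p s t = 1 by rewrite /side sp tp subr0.
rewrite /ptrans sd mul1r !surf_tval; first last.
- move=> i ip ir; rewrite pairingBl as_ at_ // eq_sym (negPf ip) subr0 //.
- by move=> i ip ir; rewrite pairingBl as_ bt_ // qi // eq_sym (negPf ip) subr0.
- by move=> i ip ir; rewrite pairingBl bs_ bt_ // subrr.
rewrite !pairingBl at_p bt_p !as_ !bs_ !at_ ?bt_ // eqxx (eq_sym p) (negPf rp).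
rewrite (qi p) 1?eq_sym // mem_bcone -/r !subr0 !subrr !expr0z !mulr1; congr mx2.
by rewrite eq_sym mulrC; case: eqP => _; rewrite ?expr1z ?expr0z.
Qed.

(** Flipping [r] keeps the character of [p], since its coordinates from [r]
    onwards vanish, and leads to a chart that does not meet [D_q]. *)
Lemma ptrans_flip2 s x y : y != 0 -> (p < r)%N -> q = bgen s r ->
  ptrans p q s (bflip s r) (surf s x y) = mx2 1 0 0 y^-1.
Proof.
move=> y0 pr qr; set t := bflip s r.
have pr' : p != r by rewrite eq_sym.
have qt : q \notin bcone t.
  rewrite mem_bcone -/r {1}qr /t /bgen /bflip eqxx.
  by case: (s r); rewrite ?eq_lrshift ?eq_rlshift.
have bt0 : char_b c q t = 0 by rewrite /char_b /bdiv (negPf qt).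
have at_ i : pairing (char_a c p t) (ray Sigma (bgen s i)) = (p == i)%:Z.
  have [->|ir] := eqVneq i r; last by rewrite -(pairing_flip _ _ ir) pairing_bdual.
  have top (j : 'I_k) : (r < j)%N -> pairing (char_a c p t) (ray Sigma (bgen t j)) = 0.
    by move=> rj; rewrite pairing_bdual -val_eqE ltn_eqF // (ltn_trans pr).
  have := pairing_top t top; rewrite pairing_bdual (negPf pr').
  rewrite (pairing_top s top) => /esym/eqP.
  by rewrite mulf_eq0 signr_eq0 => /eqP->; rewrite mulr0.
have aa0 i : pairing (char_a c p t - char_a c p s) (ray Sigma (bgen s i)) = 0.
  by rewrite pairingBl at_ pairing_bdual subrr.
have bb i : pairing (char_b c q t - char_b c q s) (ray Sigma (bgen s i)) = - (i == r)%:Z.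
  rewrite bt0 sub0r pairingNl pairing_b ?bgen_cone // qr.
  by rewrite (inj_eq (can_inj (bgenK s))) eq_sym.
have sd : side K p s t = 0 by rewrite side0 // /t /bflip (negPf pr').
rewrite /ptrans sd mul0r !surf_tval; first last.
- by move=> i _ _; rewrite aa0.
- by move=> i _ ir; rewrite bb (negPf ir) oppr0.
by rewrite !aa0 !bb eqxx (negPf pr') !expr0z !mul1r.
Qed.

(** Along a line [y = const], joining the [p]-th to the [k + p]-th divisor, the
    bundle is glued with [eta = y] if the chart meets [D_q], and with [eta = 1]
    otherwise. *)
Lemma endomorphism_on_lines s y : s p = false ->
  (r < p)%N \/ (q \notin bcone s /\ y = 0) ->
  let eta := if q \in bcone s then y else 1 in
  (eta = 0 -> N s (surf s 0 y) 1 0 = 0) /\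
  (eta != 0 -> forall w, (w - w ^+ 2) * (N s (surf s 0 y) 0 0 - N s (surf s 0 y) 1 1) =
     eta * (N s (surf s w y) 0 1 - N s (surf s 0 y) 0 1
            - w ^+ 2 * (N s (surf s 1 y) 0 1 - N s (surf s 0 y) 0 1))).
Proof.
move=> sp H eta; pose F x := N s (surf s x y).
pose F' z := N (bflip s p) (surf (bflip s p) z y).
apply: (@endomorphism_on_line K eta F F').
- by move=> z; apply: surf_rational1.
- exact: surf_rational1.
move=> x x0; rewrite /F' surf_flip1 //; last by case: H => [|[]]; [left|right].
rewrite -(ptrans_flip1 y x0 sp); last by case: H => [|[]]; [left|right].
apply: N_trans; first exact: surf_sub.
rewrite -surf_flip1 ?surf_sub //.
by case: H => [|[]]; [left|right].
Qed.

(** A chart that contains [v_p] and [v_q]. *)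
Let s0 : 'I_k -> bool := fun i => (i == r) && (q == rshift k r).

Let s0p : s0 p = false.
Proof. by rewrite /s0 eq_sym (negPf rp). Qed.

Let qs0 : q = bgen s0 r.
Proof.
rewrite /bgen /s0 eqxx /=; case: eqP => // qr.
by have [] := bidx_cases q; rewrite -/r.
Qed.

Let omega : exists w : K, w - w ^+ 2 != 0.
Proof.
have [|w] := @poly_nonroot K ('X * ('X - 1%:P)).
  by rewrite mulf_neq0 ?polyX_eq0 ?polyXsubC_eq0.
rewrite hornerM hornerX hornerXsubC => w0; exists w.
by move: w0; rewrite -oppr_eq0 -mulrN opprB mulrBr mulr1 expr2.
Qed.

(** The origin of a surface serves as the point: that of the chart containing
    [v_q] if [r < p], where the relation on the lines [y = const] is passed to
    the limit [y = 0], and that of the opposite chart if [p < r]. *)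
Lemma scalar_point : exists s x y,
  N s (surf s x y) 0 0 = N s (surf s x y) 1 1 /\
  N s (surf s x y) 0 1 * N s (surf s x y) 1 0 = 0.
Proof.
have [w w0] := omega; have qc : q \in bcone s0 by rewrite qs0 bgen_cone.
have [pr|rp'|E'] := ltngtP p r; last by move: rp; rewrite -val_eqE /= E' eqxx.
- pose s' := bflip s0 r; exists s', 0, 0.
  have qt : q \notin bcone s'.
    rewrite mem_bcone -/r {1}qs0 /s' /bgen /bflip eqxx.
    by case: (s0 r); rewrite ?eq_lrshift ?eq_rlshift.
  (* On the line [x = const] the entry [b] is a polynomial in [y], and [y * b]
     is regular at infinity, so that [b = 0]. *)
  have b0 x : N s' (surf s' x 0) 0 1 = 0.
    have rF z i j := surf_rational2 s0 x z i j; have [b Eb] := entire_poly (fun z => rF z 0 1).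
    have rel y : y != 0 -> N s' (surf s' x y^-1) 0 1 = y * b.[y].
      move=> y0; rewrite -Eb surf_flip2 //.
      have Hs : tcone (surf s0 x y) \subset bcone s'.
        by rewrite -(surf_flip2 s0 x y0 pr) surf_sub.
      have := congr1 (fun B : 'M[K]_2 => B 0 1) (N_trans (surf_sub s0 x y) Hs).
      rewrite ptrans_flip2 //= !mulmx2 !mx2E !(mulr0, mul0r, mul1r, add0r, addr0) => <-.
      by rewrite mulrC mulfVK.
    have sb : (size ('X * b)%R <= 1)%N.
      apply: (@size_pole_at_infinity _ _ 0 _ (surf_rational2 s' x 0 0 1)) => y y0.
      by rewrite mul1r rel // hornerM hornerX.
    have bz : b = 0.
      apply/eqP/negPn/negP => nb; move: sb; rewrite mulrC size_mulX // ltnNge.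
      by rewrite size_poly_gt0 nb.
    apply: (@rational_at_limit _ _ (fun w => N s' (surf s' x w) 0 1) (fun=> 0)).
    + exact: surf_rational2.
    + exact: rational_at_cst.
    apply: znearT => y y0; rewrite -[y]invrK rel ?invr_eq0 // bz horner0 mulr0 //.
  have sp' : s' p = false by rewrite /s' /bflip eq_sym (negPf rp).
  have [_] := @endomorphism_on_lines s' 0 sp' (or_intror (conj qt erefl)).
  rewrite (negPf qt) oner_neq0 => /(_ isT w); rewrite !b0 !subrr mulr0 subr0 mulr0.
  move=> /eqP; rewrite mulf_eq0 (negPf w0) subr_eq0 => /eqP ->; split=> //.
  by rewrite mul0r.
exists s0, 0, 0.
have lines y := @endomorphism_on_lines s0 y s0p (or_introl rp').
rewrite qc in lines; split; last by rewrite (lines 0).1 ?mulr0.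
pose G y := (w - w ^+ 2) * (N s0 (surf s0 0 y) 0 0 - N s0 (surf s0 0 y) 1 1).
pose G' y := y * (N s0 (surf s0 w y) 0 1 - N s0 (surf s0 0 y) 0 1
            - w ^+ 2 * (N s0 (surf s0 1 y) 0 1 - N s0 (surf s0 0 y) 0 1)).
have : G 0 = G' 0.
  apply: rational_at_limit.
  - apply: rational_atM; first exact: rational_at_cst.
    by apply: rational_atB; apply: surf_rational2.
  - apply: rational_atM; first exact: rational_at_id.
    apply: rational_atB; first by apply: rational_atB; apply: surf_rational2.
    apply: rational_atM; first exact: rational_at_cst.
    by apply: rational_atB; apply: surf_rational2.
  by apply: znearT => y y0; apply: (lines y).2.
by rewrite /G /G' mul0r => /eqP; rewrite mulf_eq0 (negPf w0) subr_eq0 => /eqP.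
Qed.

End Indecomposable.

Lemma pbundle_indecomposable (K : closedFieldType) k (c : 'I_k -> 'I_k -> nat) p q :
  bidx q != p -> indecomposable (pbundle K c p q).
Proof.
move=> rp; apply: contrapT => /decomposable_idempotent[N [idN nsN trN regN]].
have ratN s T z : rational_mx (m := 2) (n := 2) z (fun w => N s (bcurve c s T w)).
  have dz : dom (p := toric_variety K (bott_fan c)) (bchart c s) (bcurve c s T z).
    exact: bptcone_sub.
  have [r [W [A [D [B [[oW Wz] rA rB EN]]]]]] := regN s _ dz.
  move=> i j; apply: (@rational_at_near _ _ (fun w =>
    (B (bcurve c s T w) *m D *m A (bcurve c s T w)) i j)).
    by apply: znearS (bcurve_open oW Wz) => w /EN->.
  apply: rational_mxM; last exact: bcurve_regular_mx oW rA Wz.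
  by apply: rational_mxM; [apply: bcurve_regular_mx oW rB Wz|apply: rational_mx_cst].
have [s [x [y [ad bc]]]] := scalar_point rp trN ratN.
have ds : dom (p := toric_variety K (bott_fan c)) (bchart c s) (surf c p q s x y).
  exact: surf_sub.
have [a Na] := idempotent_scalar (idN s _ ds) ad bc.
exact: nsN s _ a ds Na.
Qed.

Theorem proposition6p1p1 (R : realType) (k : nat) (hk : (2 <= k)%N)
    (c : 'I_k -> 'I_k -> nat) :
  let X := bott_tower c (complex R) in
  exists E : 'I_k -> 'I_(k + k) -> vbundle X,
    forall (p : 'I_k) (q : 'I_(k + k)),
      q != lshift k p -> q != rshift k p ->
      [/\ rk (E p q) = 2%N,
          indecomposable (E p q),
          equivariant (E p q)
        & c1_eq (E p q) (tdivisor (Sigma := bott_fan c))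
            (fun l => (l == lshift k p)%:Z + (l == q)%:Z
                      + (l == rshift k p)%:Z)].
Proof.
exists (pbundle (complex R) c) => p q qp qp'; split=> //.
- apply: pbundle_indecomposable; apply/eqP => rp; move: qp qp'.
  by have [E|E] := bidx_cases q; rewrite -rp -E eqxx.
- exact: pbundle_equivariant.
- exact: pbundle_c1.
Qed.
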